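(* Let $X$ be a computable $K_\sigma$-space. Then $\mathsf{C}_X\leq_{\mathrm W}\mathsf{C}_{\mathbb{N}}\times\mathsf{C}_{\{0,1\}^{\mathbb{N}}}$.
   Context: Baire space is $\mathbb{N}^{\mathbb{N}}$, with its usual product topology and a fixed computable bijective pairing $\langle\cdot,\cdot\rangle$ on it. Computability of partial functions $F:\subseteq\mathbb{N}^{\mathbb{N}}\to\mathbb{N}^{\mathbb{N}}$ is meant via (type-2) Turing machines. A representation of a set $X$ is a surjective partial function $\delta:\subseteq\mathbb{N}^{\mathbb{N}}\to X$; $(X,\delta)$ is a represented space. $f:\subseteq X\rightrightarrows Y$ denotes a partial multi-valued function ($f(x)\neq\emptyset$ for $x\in\mathrm{dom}(f)$). A realizer of $f:\subseteq(X,\delta_X)\rightrightarrows(Y,\delta_Y)$, written $F\vdash f$, is a single-valued $F:\subseteq\mathbb{N}^{\mathbb{N}}\to\mathbb{N}^{\mathbb{N}}$ with $\delta_Y F(p)\in f\delta_X(p)$ for all $p\in\mathrm{dom}(f\delta_X)$. Weihrauch reducibility $f\leq_{\mathrm W}g$ means: there are computable $K,H:\subseteq\mathbb{N}^{\mathbb{N}}\to\mathbb{N}^{\mathbb{N}}$ such that $p\mapsto K\langle p,GH(p)\rangle$ is a realizer of $f$ for every $G\vdash g$. Sierpiński space $\mathbb{S}=\{0,1\}$ has topology $\{\emptyset,\{1\},\{0,1\}\}$ and representation $\delta_{\mathbb{S}}(p)=1\iff(\exists n)\,p(n)=0$. For a represented space $(X,\delta)$, a set $U\subseteq X$ is open if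 its characteristic function $\chi_U:X\to\mathbb{S}$ has a continuous realizer, and closed sets are the complements of open sets. $\mathcal{A}_-(X)$ is the set of closed subsets of $X$ with the representation $\psi_-^X$: a name of $A$ is a name of $\chi_{X\setminus A}$ in the canonical function space representation $[\delta\to\delta_{\mathbb{S}}]$ (a name $nq$, $n\in\mathbb N$, $q\in\mathbb{N}^{\mathbb{N}}$, names $\chi$ iff $r\mapsto\Phi_n\langle q,r\rangle$ is a realizer of $\chi$, where $\Phi_n$ is the $n$-th computable partial function on $\mathbb{N}^{\mathbb{N}}$). Closed choice is $\mathsf{C}_X:\subseteq\mathcal{A}_-(X)\rightrightarrows X,\ A\mapsto A$ with domain the non-empty closed sets (any point of $A$ is an admissible output). $\mathbb{N}$ is represented by $\delta_{\mathbb{N}}(p)=p(0)$ and $\{0,1\}^{\mathbb{N}}$ by the restricted identity. The product of multi-valued functions is $(f\times g)(x,w)=f(x)\times g(w)$, with pairs named by $\langle p,q\rangle$ where $p,q$ name the components. A computable metric space $(X,d,\alpha)$ is a separable metric space with a numbering $\alpha:\mathbb{N}\to X$ of a countable dense subset such that $(i,j)\mapsto d(\alpha(i),\alpha(j))$ is computable; it is represented by its Cauchy representation ($p$ names $\lim_i\alpha(p(i))$ provided $d(\alpha(p(i)),\alpha(p(j)))<2^{-j}$ for all $i>j$). Rational open balls are balls with center in $\mathrm{range}(\alpha)$ and rational radius. A $\kappa$-name of a compact $K\subseteq X$ is a list of (codes of) all finite covers of $K$ by rational open balls each of which has non-empty intersection with $K$; $K$ is computably compact if it has a computable $\kappa$-name,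 and a sequence $(K_i)_i$ of such sets is computable if $\kappa$-names of the $K_i$ can be computed uniformly in $i$. A computable $K_\sigma$-space is a computable metric space $X$ for which there is a computable sequence $(K_i)_{i\in\mathbb{N}}$ of non-empty computably compact sets with $X=\bigcup_{i=0}^\infty K_i$. *)

(* Defs.v *)
From mathcomp Require Import all_boot all_order all_algebra.
From mathcomp Require Import all_classical all_reals all_analysis.
From Stdlib Require Cantor.

Set Implicit Arguments.
Unset Strict Implicit.
Unset Printing Implicit Defensive.

Import Order.TTheory GRing.Theory Num.Theory.
Import numFieldNormedType.Exports.

Local Open Scope classical_set_scope.

(** * Codings of natural numbers *)

Definition npair (m n : nat) : nat := Cantor.to_nat (m, n).

Fixpoint seq_code (s : seq nat) : nat :=
  if s is n :: s' then (npair n (seq_code s')).+1 else 0.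

Lemma npair_inj m n m' n' : npair m n = npair m' n' -> m = m' /\ n = n'.
Proof. by move/Cantor.to_nat_inj => [-> ->]. Qed.

Lemma seq_code_inj : injective seq_code.
Proof.
elim=> [|m s IHs] [|n t] //= [] /npair_inj [-> /IHs ->] //.
Qed.

(** * Baire space and partial functions on it *)

Notation baire := (prod_topology (fun _ : nat => nat)).

Definition bpair (p q : baire) : baire :=
  fun n => if odd n then q n./2 else p n./2.

(* The tail q of a sequence nq. *)
Definition btail (p : baire) : baire := fun n => p n.+1.

(* A partial function is given by its graph. *)
Record pfun := PFun {
  pgraph :> baire -> baire -> Prop ;
  pfun_single : forall p q q', pgraph p q -> pgraph p q' -> q = q' }.

Definition pdom (F : pfun) : set baire := [set p | exists q, F p q].

Definition continuous_pfun (F : pfun) : Prop :=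
  exists f : baire -> baire,
    (forall p q, F p q -> f p = q) /\ {within pdom F, continuous f}.

(** * Type-2 Turing machines *)

(* Machines are flowcharts of elementary tape operations: a state is an address
   in a list of instructions, and each instruction names its successor states.
   There are a one-way read-only input tape and a one-way write-only output
   tape, both over {true, false}, and two-way infinite work tapes; as a
   program mentions finitely many work tapes and finitely many symbols, indexing
   both by nat amounts to finitely many tapes over a finite alphabet.  The
   blank symbol is 0.  An address outside of the program halts. *)
Inductive instr : Type :=
| GoLeft of nat & nat                 (* tape, next state *)
| GoRight of nat & nat                (* tape, next state *)
| Write of nat & nat & nat            (* tape, symbol, next state *)
| Test of nat & nat & nat & nat       (* tape, symbol, state if equal, if not *)
| InNext of nat                       (* next state *)
| InTest of nat & nat                 (* state if true, if false *)
| Output of bool & nat.               (* symbol, next state *)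

Definition program : Type := seq instr.

(* The head is on the first symbol of the second component; the first component
   lists what is to the left of the head, nearest first. *)
Definition tape : Type := (seq nat * seq nat)%type.

Definition tape_read (t : tape) : nat := head 0 t.2.
Definition tape_write (a : nat) (t : tape) : tape := (t.1, a :: behead t.2).
Definition tape_left (t : tape) : tape := (behead t.1, head 0 t.1 :: t.2).
Definition tape_right (t : tape) : tape := (head 0 t.2 :: t.1, behead t.2).

Record config := Config {
  state : nat ;
  in_pos : nat ;
  work : nat -> tape ;
  out : seq bool }.

Definition init_config : config := Config 0 0 (fun=> ([::], [::])) [::].

Definition set_tape (w : nat -> tape) (i : nat) (t : tape) : nat -> tape :=
  fun j => if j == i then t else w j.

Definition exec (inp : nat -> bool) (ins : instr) (c : config) : config :=
  let: Config _ h w o := c in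
  match ins with
  | GoLeft i s => Config s h (set_tape w i (tape_left (w i))) o
  | GoRight i s => Config s h (set_tape w i (tape_right (w i))) o
  | Write i a s => Config s h (set_tape w i (tape_write a (w i))) o
  | Test i a s s' => Config (if tape_read (w i) == a then s else s') h w o
  | InNext s => Config s h.+1 w o
  | InTest s s' => Config (if inp h then s else s') h w o
  | Output b s => Config s h w (rcons o b)
  end.

Definition step (P : program) (inp : nat -> bool) (c : config) : config :=
  if onth P (state c) is Some ins then exec inp ins c else c.

Definition run (P : program) (inp : nat -> bool) (t : nat) : config :=
  iter t (step P inp) init_config.

(* Tape inscriptions: p is written as 1^p(0) 0 1^p(1) 0 1^p(2) 0 ... *)
Definition unary (s : seq nat) : seq bool :=
  flatten [seq rcons (nseq n true) false | n <- s].

Definition tape_prefix (p : baire) (n : nat) : seq bool := unary (mkseq p n).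

Definition inscription (p : baire) (j : nat) : bool :=
  nth false (tape_prefix p j.+1) j.

Definition computes (P : program) (p q : baire) : Prop :=
  forall n, exists t, prefix (tape_prefix q n) (out (run P (inscription p) t)).

Lemma unary_prefix_inj (s s' : seq nat) (u : seq bool) :
  size s = size s' -> prefix (unary s) u -> prefix (unary s') u -> s = s'.
Proof.
elim: s s' u => [|m s IHs] [|n s'] // u [ss'].
rewrite /unary /= -/(unary s) -/(unary s').
elim: m n u => [|m IHm] [|n] [|[] u] //=.
- by move=> us us'; rewrite (IHs _ _ ss' us us').
- by move=> us us'; have [-> ->] := IHm _ _ us us'.
Qed.

Lemma out_run_prefix P inp t t' :
  t <= t' -> prefix (out (run P inp t)) (out (run P inp t')).
Proof.
move=> /subnK <-; elim: (t' - t) => [|k IHk]; first exact: prefix_refl.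
apply: (prefix_trans IHk); rewrite addSn /run iterS -/(run P inp (k + t)).
rewrite /step; case: onth => [ins|]; last exact: prefix_refl.
case: (run P inp (k + t)) => s h w o.
by case: ins => *; rewrite /= ?prefix_refl// -cats1 prefix_prefix.
Qed.

Lemma computes_single P p q q' : computes P p q -> computes P p q' -> q = q'.
Proof.
move=> cq cq'; apply/funext => n.
have [t qt] := cq n.+1; have [t' qt'] := cq' n.+1.
have /(prefix_trans qt) qm := out_run_prefix P (inscription p) (leq_maxl t t').
have /(prefix_trans qt') qm' := out_run_prefix P (inscription p) (leq_maxr t t').
have := unary_prefix_inj _ qm qm'.
rewrite !size_mkseq => /(_ erefl) /(congr1 (nth 0 ^~ n)).
by rewrite !nth_mkseq.
Qed.

(** * The standard numbering Phi of the computable partial functions *)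

Definition instr_code (ins : instr) : nat :=
  match ins with
  | GoLeft i s => npair 0 (npair i s)
  | GoRight i s => npair 1 (npair i s)
  | Write i a s => npair 2 (npair i (npair a s))
  | Test i a s s' => npair 3 (npair i (npair a (npair s s')))
  | InNext s => npair 4 s
  | InTest s s' => npair 5 (npair s s')
  | Output b s => npair 6 (npair b s)
  end.

Lemma instr_code_inj : injective instr_code.
Proof.
case=> [i s|i s|i a s|i a s s'|s|s s'|b s];
  case=> [j r|j r|j a' r|j a' r r'|r|r r'|b' r];
  rewrite /instr_code => /npair_inj [] // _.
- by move=> /npair_inj [-> ->].
- by move=> /npair_inj [-> ->].
- by move=> /npair_inj [-> /npair_inj [-> ->]].
- by move=> /npair_inj [-> /npair_inj [-> /npair_inj [-> ->]]].
- by move=> ->.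
- by move=> /npair_inj [-> ->].
- by move=> /npair_inj [bb' ->]; case: b b' bb' => [] [].
Qed.

Definition program_code (P : program) : nat := seq_code (map instr_code P).

Lemma program_code_inj : injective program_code.
Proof. by move=> P Q /seq_code_inj /(inj_map instr_code_inj). Qed.

(* Phi n is nowhere defined if n is not the code of a program. *)
Definition Phi_graph (n : nat) (p q : baire) : Prop :=
  exists2 P : program, program_code P = n & computes P p q.

Lemma Phi_single n p q q' : Phi_graph n p q -> Phi_graph n p q' -> q = q'.
Proof.
move=> [P <- cq] [P' /program_code_inj -> cq'].
exact: computes_single cq cq'.
Qed.

Definition Phi (n : nat) : pfun := PFun (@Phi_single n).

Definition computable (F : pfun) : Prop :=
  exists n, forall p q, F p q <-> Phi n p q.

Definition computable_point (q : baire) : Prop :=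
  exists2 F : pfun, computable F & forall p, F p q.

(** * Represented spaces and realizers *)

(* [names p x] says that p is a name of x.  All the instances below are
   single-valued and surjective, that is, representations; this is not bundled
   because surjectivity for [Aminus] is a theorem (every continuous partial
   function on Baire space is extended by some r |-> Phi_n <q, r>). *)
Record rspace := RSpace {
  rcarrier :> Type ;
  names : baire -> rcarrier -> Prop }.

(* A partial multi-valued function is a map f : X -> set Y, with
   dom f = {x | f x is non-empty}. *)
Definition realizes (X Y : rspace) (f : X -> set Y) (F : pfun) : Prop :=
  forall p x, names p x -> f x !=set0 ->
    exists q y, [/\ F p q, names q y & f x y].

Definition single (X Y : Type) (f : X -> Y) : X -> set Y := fun x => [set f x].

Definition computable_map (X Y : rspace) (f : X -> Y) : Prop :=
  exists2 F : pfun, computable F & realizes (single f) F.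

Definition continuous_map (X Y : rspace) (f : X -> Y) : Prop :=
  exists2 F : pfun, continuous_pfun F & realizes (single f) F.

Definition Nat_space : rspace :=
  @RSpace nat (fun p n => p 0 = n).

Definition Cantor_space : rspace :=
  @RSpace (nat -> bool) (fun p x => forall n, p n = x n).

Definition Sierpinski : rspace :=
  @RSpace bool (fun p b => b = true <-> exists n, p n = 0).

Definition prod_space (X Y : rspace) : rspace :=
  @RSpace (X * Y)%type (fun p z =>
    exists p1 p2, [/\ p = bpair p1 p2, names p1 z.1 & names p2 z.2]).

(* r |-> Phi_n <q, r> *)
Definition Phi_section (n : nat) (q : baire) : pfun :=
  @PFun (fun r => Phi n (bpair q r)) (fun r => @pfun_single (Phi n) (bpair q r)).

Definition function_name (X Y : rspace) (p : baire) (f : X -> Y) : Prop :=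
  realizes (single f) (Phi_section (p 0) (btail p)).

(** * Closed sets and closed choice *)

Definition char_fun (X : rspace) (U : set X) : X -> Sierpinski :=
  fun x => x \in U.

Definition ropen (X : rspace) (U : set X) : Prop := continuous_map (char_fun U).

Definition rclosed (X : rspace) (A : set X) : Prop := ropen (~` A).

Definition Aminus (X : rspace) : rspace :=
  @RSpace {A : set X | rclosed A}
    (fun p A => function_name p (char_fun (~` sval A))).

Definition closed_choice (X : rspace) : Aminus X -> set X := fun A => sval A.

(** * Weihrauch reducibility *)

Definition mprod (X Y Z W : rspace) (f : X -> set Y) (g : Z -> set W) :
    prod_space X Z -> set (prod_space Y W) :=
  fun z => f z.1 `*` g z.2.

(* p |-> K <p, G (H p)> *)
Definition sandwich_graph (K G H : pfun) (p r : baire) : Prop :=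
  exists h g, [/\ H p h, G h g & K (bpair p g) r].

Lemma sandwich_single (K G H : pfun) p r r' :
  sandwich_graph K G H p r -> sandwich_graph K G H p r' -> r = r'.
Proof.
move=> [h [g [Hh Gg Kr]]] [h' [g' [Hh' Gg' Kr']]].
move: Gg'; rewrite -(pfun_single Hh Hh') => Gg'.
move: Kr'; rewrite -(pfun_single Gg Gg') => Kr'.
exact: pfun_single Kr Kr'.
Qed.

Definition sandwich (K G H : pfun) : pfun := PFun (@sandwich_single K G H).

Definition weihrauch_le (X Y Z W : rspace)
    (f : X -> set Y) (g : Z -> set W) : Prop :=
  exists K H : pfun, [/\ computable K, computable H &
    forall G : pfun, realizes g G -> realizes f (sandwich K G H)].

(** * Computable metric spaces *)

Local Open Scope ring_scope.

Section ComputableMetric.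
Variable R : realType.

(* The Cauchy representation of X relative to alpha. *)
Definition Cauchy_space (X : metricType R) (alpha : nat -> X) : rspace :=
  @RSpace X (fun p x =>
    (forall i j : nat, (j < i)%N ->
       mdist (alpha (p i)) (alpha (p j)) < 2 ^- j) /\
    (fun i => alpha (p i)) @ \oo --> x).

(* Standard numbering of the rationals: <i, <j, k>> |-> (i - j) / (k + 1). *)
Definition nuQ (n : nat) : R :=
  let: (i, m) := Cantor.of_nat n in
  let: (j, k) := Cantor.of_nat m in
  (i%:R - j%:R) / k.+1%:R.

Definition Real_space : rspace := @Cauchy_space R^o nuQ.

Definition computable_metric (X : metricType R) (alpha : nat -> X) : Prop :=
  dense (range alpha) /\
  @computable_map (prod_space Nat_space Nat_space) Real_space
    (fun ij => mdist (alpha ij.1) (alpha ij.2)).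

Section KappaNames.
Variables (X : metricType R) (alpha : nat -> X).

(* The pair (a, r) stands for the ball with centre alpha a and radius nuQ r. *)
Definition rball (b : nat * nat) : set X := ball (alpha b.1) (nuQ b.2).

Definition cover_code (l : seq (nat * nat)) : nat :=
  seq_code [seq npair b.1 b.2 | b <- l].

Definition meeting_cover (K : set X) (l : seq (nat * nat)) : Prop :=
  K `<=` \bigcup_(b in [set` l]) rball b /\
  (forall b, b \in l -> K `&` rball b !=set0).

Definition kappa_name (p : baire) (K : set X) : Prop :=
  range p = [set cover_code l | l in meeting_cover K].

Definition computably_compact (K : set X) : Prop :=
  compact K /\ exists2 p : baire, computable_point p & kappa_name p K.

Definition computable_compact_seq (K : nat -> set X) : Prop :=
  exists2 F : pfun, computable F &
    forall p i, @names Nat_space p i -> exists2 q, F p q & kappa_name q (K i).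

Definition computable_Ksigma : Prop :=
  computable_metric alpha /\
  exists K : nat -> set X,
    [/\ forall i, K i !=set0 /\ computably_compact (K i),
        computable_compact_seq K &
        \bigcup_i K i = setT].

End KappaNames.
End ComputableMetric.

(* Main.v *)
Require Import Defs.
From mathcomp Require Import all_boot all_order all_algebra.
From mathcomp Require Import all_classical all_reals all_analysis.
From mathcomp Require Import zify lra ring.

(** Let A be a non-empty closed subset of X, and let K_0, K_1, ... be the given
    compact sets, which cover X. Enumerating the kappa-name of K_i until the
    radii are small yields, for every j, a finite cover of K_i by rational
    balls of radius at most 2^-(j+2). A point of K_i is described by choosing
    one ball in each of these covers, and a point x of Cantor space codes such
    choices for all i at once ([address], [choice]).

    If the chosen centres c_0, c_1, ... satisfy d(c_j, c_j') <= 2^-(j+1) for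
    j < j', then they converge, since K_i is compact, and they are a Cauchy
    name of their limit. That this inequality fails, or that the limit is
    outside of A, can be recognized from finitely many bits of x and finitely
    many entries of the name of A: the first by computing a distance, the
    second by running the name of A on the centres ([reject]). So the choices
    that describe points of A in K_i are the infinite branches of a binary tree
    T_i whose complement is enumerated from the name of A ([pruned_sound],
    [pruned_complete]).

    The indices i with T_i infinite form a closed set [index_set] of numbers: as
    soon as a level of T_i is empty, this is seen. It is non-empty, because a
    point of A lies in some K_i. The choice of a branch must be made in
    parallel with the choice of i, hence for all i, including those for which
    T_i is finite. This is why [point_set] asks that x leave T_i only at levels
    where T_i has no nodes: if T_i is infinite this means that x is a branch,
    by definition, and otherwise any x that follows a longest node of T_i will
    do; Koenig's lemma ([konig]) ensures that T_i has a branch if it is infinite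
    ([late_branch]). As T_i only depends on the bits of x whose address starts
    with i, a common x exists for all i ([point_set_nonempty]). Given i and x,
    the centres chosen by x for i are computable and name a point of A
    ([selected_point]).

    It remains to see that the maps involved are computed by machines. All of
    them have the form: read the input until a primitive recursive function of
    the prefix read so far and of the output position returns a value. Loop
    programs with finitely many registers compute all primitive recursive
    functions ([exec_cmd_of]) and compile to machines ([compile_correct]), so
    that such maps are computable ([primrec_machine]). Conversely, what a
    program outputs in n steps on a prefix of length n is a primitive recursive
    function of the code of the program and of the prefix ([output_prefix],
    [primrec_output_prefix]), and this is all that is used of the machines for
    the distance, for the compact sets and for the name of A. *)

Set Implicit Arguments.
Unset Strict Implicit.
Unset Printing Implicit Defensive.

(** * Tape inscriptions *)

Lemma unary_cat s t : unary (s ++ t) = unary s ++ unary t.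
Proof. by rewrite /unary map_cat flatten_cat. Qed.

Lemma leq_size_unary s : size s <= size (unary s).
Proof.
elim: s => //= n s IHs; rewrite /unary /= -/(unary s) size_cat size_rcons.
by rewrite size_nseq; lia.
Qed.

Lemma mkseq_prefix (p : baire) m n : m <= n -> prefix (mkseq p m) (mkseq p n).
Proof.
by move=> mn; rewrite /mkseq -(subnKC mn) iotaD map_cat prefix_prefix.
Qed.

Lemma unary_prefix s t : prefix s t -> prefix (unary s) (unary t).
Proof. by case/prefixP => u ->; rewrite unary_cat prefix_prefix. Qed.

Lemma nth_prefix (T : eqType) (x : T) s t i :
  prefix s t -> i < size s -> nth x t i = nth x s i.
Proof. by case/prefixP => u -> lti; rewrite nth_cat lti. Qed.

Lemma inscriptionE (p : baire) n j :
  j < size (tape_prefix p n) -> inscription p j = nth false (tape_prefix p n) j.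
Proof.
move=> ltj; have ltj' : j < size (tape_prefix p j.+1).
  by apply: leq_trans (leq_size_unary _); rewrite size_mkseq.
rewrite /inscription; case: (leqP n j.+1) => [le | /ltnW le].
  by apply: nth_prefix => //; apply/unary_prefix/mkseq_prefix.
by apply/esym/nth_prefix => //; apply/unary_prefix/mkseq_prefix.
Qed.

Lemma tape_prefixS (p : baire) m :
  tape_prefix p m.+1 = tape_prefix p m ++ rcons (nseq (p m) true) false.
Proof. by rewrite /tape_prefix mkseqS -cats1 unary_cat /unary /= cats0. Qed.

Lemma inscription_block (p : baire) m j :
  j <= p m -> inscription p (size (tape_prefix p m) + j) = (j < p m).
Proof.
move=> lej; rewrite (@inscriptionE p m.+1).
  rewrite tape_prefixS nth_cat ltnNge leq_addr /= addKn nth_rcons size_nseq.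
  by rewrite nth_nseq; case: ltnP => // pj; rewrite if_same.
by rewrite tape_prefixS size_cat ltn_add2l size_rcons size_nseq.
Qed.

(** * A small imperative language and its compilation to machines *)

(** [Loop x c] decrements register x before each pass of c and stops when the
    register is 0; it is the only test. [Read x] adds the next input entry to
    register x. *)
Inductive cmd : Type :=
| Skip
| Inc of nat
| Emit of bool
| Read of nat
| Seq of cmd & cmd
| Loop of nat & cmd.

Declare Scope cmd_scope.
Delimit Scope cmd_scope with cmd.
Bind Scope cmd_scope with cmd.
Notation "c ;; d" := (Seq c d) (at level 60, right associativity) : cmd_scope.

Definition upd (r : nat -> nat) (x v : nat) : nat -> nat :=
  fun y => if y == x then v else r y.

(** Register contents, number of input entries read, output so far. *)
Definition store : Type := ((nat -> nat) * (nat * seq bool))%type.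

Inductive exec_cmd (p : baire) : cmd -> store -> store -> Prop :=
| ExecSkip s : exec_cmd p Skip s s
| ExecInc x r io : exec_cmd p (Inc x) (r, io) (upd r x (r x).+1, io)
| ExecEmit b r m o : exec_cmd p (Emit b) (r, (m, o)) (r, (m, rcons o b))
| ExecRead x r m o :
    exec_cmd p (Read x) (r, (m, o)) (upd r x (r x + p m), (m.+1, o))
| ExecSeq c d s1 s2 s3 :
    exec_cmd p c s1 s2 -> exec_cmd p d s2 s3 -> exec_cmd p (Seq c d) s1 s3
| ExecLoop0 x c r io : r x = 0 -> exec_cmd p (Loop x c) (r, io) (r, io)
| ExecLoopS x c r io s2 s3 : 0 < r x ->
    exec_cmd p c (upd r x (r x).-1, io) s2 -> exec_cmd p (Loop x c) s2 s3 ->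
    exec_cmd p (Loop x c) (r, io) s3.

Fixpoint cmd_size (c : cmd) : nat :=
  match c with
  | Skip => 0
  | Inc _ => 2
  | Emit _ => 1
  | Read _ => 5
  | Seq c d => cmd_size c + cmd_size d
  | Loop _ c => cmd_size c + 4
  end.

(** The code is placed at address a and exits at [a + cmd_size c]. A register is
    a stack of ones: it is tested by moving left, which also decrements it. A
    [Test] whose two successors agree serves as a jump. *)
Fixpoint compile (a : nat) (c : cmd) : program :=
  match c with
  | Skip => [::]
  | Inc x => [:: Write x 1 a.+1; GoRight x a.+2]
  | Emit b => [:: Output b a.+1]
  | Read x => [:: InTest a.+1 a.+4; InNext a.+2; Write x 1 a.+3; GoRight x a;
                  InNext (a + 5)]
  | Seq c d => compile a c ++ compile (a + cmd_size c) d
  | Loop x c => [:: GoLeft x a.+1; Test x 1 a.+3 a.+2;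
                    GoRight x (a + (cmd_size c + 4))]
                  ++ compile a.+3 c ++ [:: Test 0 0 a a]
  end.

Lemma size_compile a c : size (compile a c) = cmd_size c.
Proof.
elim: c a => //= [c IHc d IHd|x c IHc] a; first by rewrite size_cat IHc IHd.
by rewrite size_cat IHc /=; lia.
Qed.

Definition loaded (P : program) (a : nat) (Q : program) : Prop :=
  forall k ins, onth Q k = Some ins -> onth P (a + k) = Some ins.

Lemma loaded_catl P a Q Q' : loaded P a (Q ++ Q') -> loaded P a Q.
Proof.
move=> h k ins e; apply: h; rewrite onth_cat.
by case: ltnP => //; move/onth_default; rewrite e.
Qed.

Lemma loaded_catr P a Q Q' : loaded P a (Q ++ Q') -> loaded P (a + size Q) Q'.
Proof.
move=> h k ins e; rewrite -addnA; apply: h; rewrite onth_cat.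
by rewrite ltnNge leq_addr /= addKn.
Qed.

(** The stack of n ones rests on blanks that earlier zero tests have visited;
    what lies under the head and to its right is garbage. *)
Definition counter (n : nat) (t : tape) : Prop :=
  exists k, t.1 = nseq n 1 ++ nseq k 0.

Definition represents (p : baire) (c : config) (s : store) : Prop :=
  [/\ forall x, counter (s.1 x) (work c x),
      in_pos c = size (tape_prefix p s.2.1) & out c = s.2.2].

Definition reaches (P : program) (p : baire) (c c' : config) : Prop :=
  exists t, iter t (step P (inscription p)) c = c'.

Lemma reaches_refl P p c : reaches P p c c.
Proof. by exists 0. Qed.

Lemma reaches_trans P p c1 c2 c3 :
  reaches P p c1 c2 -> reaches P p c2 c3 -> reaches P p c1 c3.
Proof. by move=> [t <-] [u <-]; exists (u + t); rewrite iterD. Qed.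

Lemma reaches_step P p c ins c' : onth P (state c) = Some ins ->
  reaches P p (exec (inscription p) ins c) c' -> reaches P p c c'.
Proof.
by move=> e [t <-]; exists t.+1; rewrite iterSr /step e.
Qed.

Lemma counter_set n w x t y (r : nat -> nat) :
  (forall y, counter (r y) (w y)) -> counter n t ->
  counter (upd r x n y) (set_tape w x t y).
Proof. by move=> h ht; rewrite /upd /set_tape; case: eqP. Qed.

Definition implements (P : program) (p : baire) (a b : nat) (s s' : store) :=
  forall c, state c = a -> represents p c s ->
  exists c', [/\ reaches P p c c', state c' = b & represents p c' s'].

Lemma loaded_at P a Q b k ins :
  loaded P a Q -> b = a + k -> onth Q k = Some ins -> onth P b = Some ins.
Proof. by move=> ld -> /ld. Qed.

Lemma compile_correct P p c s s' : exec_cmd p c s s' ->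
  forall a, loaded P a (compile a c) -> implements P p a (a + cmd_size c) s s'.
Proof.
elim=> {c s s'}.
- move=> s a _ c ca rc; exists c; split=> //; first exact: reaches_refl.
  by rewrite addn0.
- move=> x r io a ld [q h w o] /= -> [/= cw ch co]; eexists; split.
  + apply: reaches_step;
        first by apply: (loaded_at ld (k := 0)); rewrite ?addn0.
    apply: reaches_step;
        first by apply: (loaded_at ld (k := 1)); rewrite ?addn1.
    exact: reaches_refl.
  + by rewrite /= addn2.
  + split=> // y /=; rewrite /set_tape /upd eqxx.
    case: eqP => [_|_]; last exact: cw.
    by have [k wk] := cw x; exists k; rewrite /= wk.
- move=> b r m o a ld [q h w o'] /= -> [/= cw ch co]; eexists; split.
  + apply: reaches_step;
        first by apply: (loaded_at ld (k := 0)); rewrite ?addn0.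
    exact: reaches_refl.
  + by rewrite /= addn1.
  + by split=> //=; rewrite co.
- move=> x r m o a ld.
  (* n is the number of ones of the entry that are still ahead of the head. *)
  suff loop n : n <= p m -> forall c r', state c = a ->
      (forall y, counter (r' y) (work c y)) ->
      in_pos c = size (tape_prefix p m) + (p m - n) -> out c = o ->
      exists c', [/\ reaches P p c c', state c' = a + 5 &
        represents p c' (upd r' x (r' x + n), (m.+1, o))].
    move=> c ca [/= cw ch co]; apply: (loop (p m)) => //.
    by rewrite subnn addn0.
  elim: n => [|n IHn] np [q h w o'] r' /= -> cw ch co.
    eexists; split.
    * apply: reaches_step;
        first by apply: (loaded_at ld (k := 0)); rewrite ?addn0.
      rewrite /= ch inscription_block ?leq_subr // subn0 ltnn.
      apply: reaches_step;
        first by apply: (loaded_at ld (k := 4)); rewrite ?addn4.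
      exact: reaches_refl.
    * by [].
    * split=> //=; last by
        rewrite tape_prefixS size_cat size_rcons size_nseq ?ch ?subn0 addnS.
      by move=> y; rewrite /upd addn0; case: eqP => [->|_]; exact: cw.
  have np' : p m - n.+1 < p m by lia.
  have [c' [h1 h2 h3]] : exists c', [/\ reaches P p
      (Config a h.+1 (set_tape w x (tape_right (tape_write 1 (w x)))) o) c',
      state c' = a + 5 &
      represents p c' (upd (upd r' x (r' x).+1) x ((upd r' x (r' x).+1) x + n),
                       (m.+1, o))].
    apply: (IHn (ltnW np)) => //=; last by rewrite ch; lia.
    move=> y; apply: counter_set => //.
    by have [k wk] := cw x; exists k; rewrite /= wk.
  exists c'; split=> //.
  + apply: reaches_step;
        first by apply: (loaded_at ld (k := 0)); rewrite ?addn0.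
    rewrite /= ch inscription_block ?leq_subr // np'.
    apply: reaches_step;
        first by apply: (loaded_at ld (k := 1)); rewrite ?addn1.
    apply: reaches_step;
        first by apply: (loaded_at ld (k := 2)); rewrite ?addn2.
    apply: reaches_step;
        first by apply: (loaded_at ld (k := 3)); rewrite ?addn3.
    rewrite /= /set_tape eqxx; move: h1; rewrite co ch;
      congr (reaches _ _ (Config _ _ _ _) _).
    by apply/funext => y; rewrite /set_tape; case: (y == x).
  + move: h3; congr (represents _ _ (_, _)); apply/funext => y.
    by rewrite /upd eqxx; case: (y == x) => //; rewrite addSnnS.
- move=> c d s1 s2 s3 _ IHc _ IHd a /= ld c1 c1a rc1.
  have [c2 [h2 h2' h2'']] := IHc a (loaded_catl ld) c1 c1a rc1.
  have ldd := loaded_catr ld; rewrite size_compile in ldd.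
  have [c3 [h3 h3' h3'']] := IHd _ ldd c2 h2' h2''.
  exists c3; split=> //; last by rewrite h3' addnA.
  exact: reaches_trans h2 h3.
- move=> x c r io rx0 a ld [q h w o] /= -> [/= cw ch co]; eexists; split.
  + apply: reaches_step;
        first by apply: (loaded_at ld (k := 0)); rewrite ?addn0.
    apply: reaches_step;
        first by apply: (loaded_at ld (k := 1)); rewrite ?addn1.
    rewrite /= /set_tape eqxx /=.
    have -> : (tape_read (tape_left (w x)) == 1) = false.
      by have [k] := cw x; rewrite rx0 /tape_read /tape_left /= => ->; case: k.
    apply: reaches_step;
        first by apply: (loaded_at ld (k := 2)); rewrite ?addn2.
    exact: reaches_refl.
  + by [].
  + split=> // y /=; rewrite /set_tape eqxx; case: eqP => [->|_]; last exact: cw.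
    rewrite rx0; have [k] := cw x; rewrite rx0 /tape_right /tape_left /= => ->.
    by case: k => [|k]; [exists 1 | exists k.+1].
- move=> x c r io s2 s3 rx0 _ IHc _ IHl a ld [q h w o] /= -> [/= cw ch co].
  have ldc : loaded P a.+3 (compile a.+3 c).
    have := loaded_catr (Q := [:: _; _; _]) ld; rewrite addn3.
    exact: loaded_catl.
  set c1 := Config a.+3 h (set_tape w x (tape_left (w x))) o.
  have rc1 : represents p c1 (upd r x (r x).-1, io).
    split=> // y; apply: counter_set => //.
    have [k wk] := cw x; exists k; rewrite /= wk.
    by case: (r x) rx0.
  have [c2 [h2 h2' h2'']] := IHc _ ldc c1 erefl rc1.
  have [c3 [h3 h3' h3'']] := IHl a ld
    (Config a (in_pos c2) (work c2) (out c2)) erefl h2''.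
  exists c3; split=> //.
  apply: reaches_step;
        first by apply: (loaded_at ld (k := 0)); rewrite ?addn0.
  apply: reaches_step;
        first by apply: (loaded_at ld (k := 1)); rewrite ?addn1.
  rewrite /= /set_tape eqxx /=.
  have -> : (tape_read (tape_left (w x)) == 1) = true.
    have [k] := cw x; rewrite /tape_read /tape_left /= => ->.
    by case: (r x) rx0.
  apply: reaches_trans h2 _.
  apply: reaches_step.
    apply: (loaded_at ld (k := cmd_size c + 3)); first by rewrite h2'; lia.
    by rewrite addn3 /= onth_cat size_compile ltnn subnn.
  by move: h3; case: (c2) => q2 i2 w2 o2 /=; rewrite if_same.
Qed.

(** * Loop programs for pairing and iteration *)

Section ExecLemmas.
Variable p : baire.

Lemma exec_eq c s s1 s2 : exec_cmd p c s s1 -> s1 = s2 -> exec_cmd p c s s2.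
Proof. by move=> h <-. Qed.

(** A loop is verified by exhibiting the store [st k] after k of its n passes. *)
Lemma exec_loop x c (st : nat -> store) n :
  (forall k, k <= n -> (st k).1 x = n - k) ->
  (forall k, k < n ->
    exec_cmd p c (upd (st k).1 x (n - k.+1), (st k).2) (st k.+1)) ->
  exec_cmd p (Loop x c) (st 0) (st n).
Proof.
elim: n st => [|n IHn] st stx stc.
  by move: (stx 0 isT); case: (st 0) => r io /= ?; apply: ExecLoop0.
have := stx 0 isT; have := stc 0 isT.
case: (st 0) => r io /= h rx; apply: (@ExecLoopS _ _ _ _ _ (st 1)).
- by rewrite rx.
- by move: h; rewrite rx subn0 subn1.
- apply: (IHn (fun k => st k.+1)) => k kn; first by rewrite stx.
  exact: stc.
Qed.

Definition move_reg x y := Loop x (Inc y).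
Definition clear_reg x := Loop x Skip.

Lemma exec_move x y r io : x != y ->
  exec_cmd p (move_reg x y) (r, io) (upd (upd r x 0) y (r y + r x), io).
Proof.
move=> xy; set st := fun k => (upd (upd r x (r x - k)) y (r y + k), io) : store.
have -> : (r, io) = st 0.
  by congr pair; apply/funext => z; rewrite /upd; do 2?case: eqP => ?; subst; lia.
apply: (@exec_eq _ _ (st (r x))).
  apply: exec_loop => k kx; first by rewrite /= /upd (negbTE xy) eqxx.
  apply: exec_eq (ExecInc _ _ _ _) _; congr pair.
  by apply/funext => z; rewrite /= /upd; do 3?case: eqP => ?; subst; lia.
by congr pair; apply/funext => z; rewrite /upd; do 2?case: eqP => ?; subst; lia.
Qed.

Lemma exec_clear x r io : exec_cmd p (clear_reg x) (r, io) (upd r x 0, io).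
Proof.
set st := fun k => (upd r x (r x - k), io) : store.
have -> : (r, io) = st 0.
  by congr pair; apply/funext => z; rewrite /upd; do 2?case: eqP => ?; subst; lia.
apply: (@exec_eq _ _ (st (r x))).
  apply: exec_loop => k kx; first by rewrite /= /upd eqxx.
  apply: exec_eq (ExecSkip _ _) _; congr pair.
  by apply/funext => z; rewrite /= /upd; do 3?case: eqP => ?; subst; lia.
by congr pair; apply/funext => z; rewrite /upd; do 2?case: eqP => ?; subst; lia.
Qed.

End ExecLemmas.

(** Decides the comparisons of register names in the goal, splitting only on
    those that the hypotheses leave open. *)
Ltac decide_regs :=
  rewrite /= /upd /=;
  repeat match goal with
  | |- context [@eq_op _ ?x ?x] => rewrite eqxx /=
  | |- context [@eq_op _ ?x ?y] => first
      [ have -> : (x == y) = false by lia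
      | have -> : (x == y) = true by lia
      | let H := fresh in case: (x =P y) => [H|H]; [subst|]]; rewrite /=
  end.

Ltac regs := congr pair; apply/funext => ?; decide_regs; try lia.

(** Adds x to y and preserves x; t is a scratch register. *)
Definition copy_reg x y t := (Loop x (Inc y ;; Inc t) ;; move_reg t x)%cmd.

Lemma exec_copy p x y t r io : uniq [:: x; y; t] -> r t = 0 ->
  exec_cmd p (copy_reg x y t) (r, io) (upd r y (r y + r x), io).
Proof.
rewrite /= !inE negb_or => /and3P[/andP[xy xt] yt _] rt.
set st := fun k => (upd (upd (upd r x (r x - k)) y (r y + k)) t k, io) : store.
apply: (@ExecSeq _ _ _ _ (st (r x))).
  have -> : (r, io) = st 0 by regs.
  apply: exec_loop => k kx; first by decide_regs; lia.
  apply: ExecSeq (ExecInc _ _ _ _) _; apply: exec_eq (ExecInc _ _ _ _) _; regs.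
by apply: exec_eq; [apply: exec_move; lia|regs].
Qed.

Definition tri (n : nat) : nat :=
  nat_rec (fun _ => nat) 0 (fun i m => i.+1 + m) n.

Arguments tri : simpl never.

Lemma triS n : tri n.+1 = n.+1 + tri n.
Proof. by []. Qed.

Lemma npairE m n : npair m n = n + tri (n + m).
Proof. by []. Qed.

Lemma leq_tri m n : m <= n -> tri m <= tri n.
Proof. 
elim: n m => [|n IHn] [|m] // mn; rewrite !triS.
by have := IHn m mn; lia.
Qed.

(** The first loop forms z = n + m, where m and n are in registers b and b.+1;
    the second one adds z + (z - 1) + ... + 1 to n. *)
Definition pairing b :=
  (Loop b.+1 (Inc b ;; Inc b.+2) ;;
   Loop b (Inc b.+2 ;; copy_reg b b.+2 b.+3) ;; move_reg b.+2 b)%cmd.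

Lemma exec_pairing p b r io : r b.+2 = 0 -> r b.+3 = 0 ->
  exec_cmd p (pairing b) (r, io)
    (upd (upd r b (npair (r b) (r b.+1))) b.+1 0, io).
Proof.
move=> r2 r3; set m := r b; set n := r b.+1.
set st := fun k => (upd (upd (upd r b (m + k)) b.+1 (n - k)) b.+2 k, io) : store.
set z := n + m.
set st' := fun k => (upd (upd (upd r b (z - k)) b.+1 0) b.+2
  (n + (tri z - tri (z - k))), io) : store.
apply: (@ExecSeq _ _ _ _ (st n)).
  have -> : (r, io) = st 0 by rewrite /m /n; regs.
  apply: exec_loop => k kn; first by decide_regs; lia.
  apply: ExecSeq (ExecInc _ _ _ _) _; apply: exec_eq (ExecInc _ _ _ _) _; regs.
apply: (@ExecSeq _ _ _ _ (st' z)).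
  have -> : st n = st' 0 by rewrite /st /st' subn0 subnn /z; regs.
  apply: exec_loop => k kz; first by decide_regs; lia.
  apply: ExecSeq (ExecInc _ _ _ _) _; apply: exec_eq (exec_copy _ _ _ _) _.
  - by rewrite /= !inE; lia.
  - by decide_regs; lia.
  - have h1 : tri (z - k) <= tri z by apply: leq_tri; lia.
    have h2 : tri (z - k) = (z - k) + tri (z - k.+1) by rewrite -subnSK.
    regs.
apply: exec_eq; first by apply: exec_move; lia.
have zz : tri (z - z) = 0 by rewrite subnn.
by rewrite npairE -/z /st'; regs.
Qed.

(** One step of the enumeration of the pairs along the antidiagonals. *)
Definition cantor_step (xy : nat * nat) : nat * nat :=
  if xy.1 is x.+1 then (x, xy.2.+1) else (xy.2.+1, 0).

Lemma of_natE n : Cantor.of_nat n = iter n cantor_step (0, 0).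
Proof.
elim: n => // n; rewrite iterS => <-.
rewrite {1}/Cantor.of_nat /= -/(Cantor.of_nat n).
by case: (Cantor.of_nat n) => [[]].
Qed.

(** Walks through the enumeration of the pairs, with the current pair in b and
    b.+1; the flag b.+3 remains set if the first component is 0 and a new
    antidiagonal begins. *)
Definition unpairing b :=
  (move_reg b b.+2 ;;
   Loop b.+2 (Inc b.+3 ;;
              Loop b (clear_reg b.+3 ;; move_reg b b.+4 ;; Inc b.+1) ;;
              move_reg b.+4 b ;; Loop b.+3 (move_reg b.+1 b ;; Inc b)))%cmd.

Lemma exec_unpairing p b r io :
  r b.+1 = 0 -> r b.+2 = 0 -> r b.+3 = 0 -> r b.+4 = 0 ->
  exec_cmd p (unpairing b) (r, io)
    (upd (upd r b (Cantor.of_nat (r b)).1) b.+1 (Cantor.of_nat (r b)).2, io).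
Proof.
move=> r1 r2 r3 r4; set z := r b.
set v := fun k => iter k cantor_step (0, 0).
set st := fun k =>
  (upd (upd (upd r b (v k).1) b.+1 (v k).2) b.+2 (z - k), io) : store.
apply: (@ExecSeq _ _ _ _ (st 0)).
  apply: exec_eq; first by apply: exec_move; lia.
  by rewrite /st /v /= /z; regs.
apply: (@exec_eq _ _ _ (st z)); last first.
  by rewrite of_natE -/(v z) /st; regs.
apply: exec_loop => k kz.
  by decide_regs; lia.
rewrite /st /=; case: (v k) => [[|x] y] /=.
  apply: ExecSeq (ExecInc _ _ _ _) _.
  apply: ExecSeq; first by apply: ExecLoop0; decide_regs; lia.
  apply: ExecSeq; first by apply: exec_move; lia.
  apply: ExecLoopS; first by decide_regs; lia.
    apply: ExecSeq; first by apply: exec_move; lia.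
    exact: ExecInc.
  apply: exec_eq; first by apply: ExecLoop0; decide_regs; lia.
  regs.
apply: ExecSeq (ExecInc _ _ _ _) _.
apply: ExecSeq.
  apply: ExecLoopS; first by decide_regs; lia.
    apply: ExecSeq; first exact: exec_clear.
    apply: ExecSeq; first by apply: exec_move; lia.
    exact: ExecInc.
  by apply: ExecLoop0; decide_regs; lia.
apply: ExecSeq; first by apply: exec_move; lia.
apply: exec_eq; first by apply: ExecLoop0; decide_regs; lia.
regs.
Qed.

(** * Primitive recursive functions *)

(** Unary functions suffice, as arguments can be packed by the Cantor pairing.
    [CIter] iterates; primitive recursion results from iterating on a pair that
    holds a counter. *)
Inductive pr_code : Type :=
| CZero
| CSucc
| CId
| CFst
| CSnd
| CPair of pr_code & pr_code
| CComp of pr_code & pr_code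
| CIter of pr_code.

Fixpoint eval_code (c : pr_code) (z : nat) : nat :=
  match c with
  | CZero => 0
  | CSucc => z.+1
  | CId => z
  | CFst => (Cantor.of_nat z).1
  | CSnd => (Cantor.of_nat z).2
  | CPair c d => npair (eval_code c z) (eval_code d z)
  | CComp c d => eval_code c (eval_code d z)
  | CIter c => let: (n, x) := Cantor.of_nat z in iter n (eval_code c) x
  end.

Definition swap_regs x y t :=
  (move_reg x t ;; move_reg y x ;; move_reg t y)%cmd.

(** The argument is taken from register b, which receives the value; the
    registers above b are scratch and must be 0 before and after. *)
Fixpoint cmd_of (c : pr_code) (b : nat) : cmd :=
  match c with
  | CZero => clear_reg b
  | CSucc => Inc b
  | CId => Skip
  | CFst => unpairing b ;; clear_reg b.+1
  | CSnd => unpairing b ;; clear_reg b ;; move_reg b.+1 b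
  | CPair c d => copy_reg b b.+1 b.+2 ;; cmd_of c b.+1 ;;
                 swap_regs b b.+1 b.+2 ;; cmd_of d b.+1 ;; pairing b
  | CComp c d => cmd_of d b ;; cmd_of c b
  | CIter c => unpairing b ;; Loop b (cmd_of c b.+1) ;; move_reg b.+1 b
  end%cmd.

Lemma exec_cmd_of p c b r io : (forall y, b < y -> r y = 0) ->
  exec_cmd p (cmd_of c b) (r, io) (upd r b (eval_code c (r b)), io).
Proof.
elim: c b r => /= [||||| c IHc d IHd | c IHc d IHd | c IHc] b r r0.
- exact: exec_clear.
- exact: ExecInc.
- apply: exec_eq (ExecSkip _ _) _; regs.
- have [r1 r2 r3 r4] : [/\ r b.+1 = 0, r b.+2 = 0, r b.+3 = 0 & r b.+4 = 0].
    by split; apply: r0; lia.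
  apply: ExecSeq (exec_unpairing _ _ _ _ _ _) _ => //.
  apply: exec_eq (exec_clear _ _ _ _) _; regs.
- have [r1 r2 r3 r4] : [/\ r b.+1 = 0, r b.+2 = 0, r b.+3 = 0 & r b.+4 = 0].
    by split; apply: r0; lia.
  apply: ExecSeq (exec_unpairing _ _ _ _ _ _) _ => //.
  apply: ExecSeq (exec_clear _ _ _ _) _.
  by apply: exec_eq; [apply: exec_move; lia | regs].
- have [r1 r2 r3] : [/\ r b.+1 = 0, r b.+2 = 0 & r b.+3 = 0].
    by split; apply: r0; lia.
  apply: ExecSeq; first by apply: exec_copy; rewrite /= ?inE; lia.
  apply: ExecSeq.
    by apply: IHc => y by_; decide_regs; apply: r0; lia.
  apply: (@ExecSeq _ _ _ _ (upd (upd r b (eval_code c (r b))) b.+1 (r b), io)).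
    apply: ExecSeq; first by apply: exec_move; lia.
    apply: ExecSeq; first by apply: exec_move; lia.
    by apply: exec_eq; [apply: exec_move; lia | rewrite r1; regs].
  apply: ExecSeq.
    by apply: IHd => y by_; decide_regs; apply: r0; lia.
  apply: exec_eq; first by apply: exec_pairing; decide_regs; lia.
  regs.
- apply: ExecSeq; first exact: IHd.
  apply: exec_eq; first by apply: IHc => y by_; decide_regs; apply: r0; lia.
  regs.
- have [r1 r2 r3 r4] : [/\ r b.+1 = 0, r b.+2 = 0, r b.+3 = 0 & r b.+4 = 0].
    by split; apply: r0; lia.
  apply: ExecSeq (exec_unpairing _ _ _ _ _ _) _ => //.
  case: (Cantor.of_nat (r b)) => n x /=.
  set st := fun k =>
    (upd (upd r b (n - k)) b.+1 (iter k (eval_code c) x), io) : store.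
  apply: (@ExecSeq _ _ _ _ (st n)).
    have -> : (upd (upd r b n) b.+1 x, io) = st 0 by rewrite /st /=; regs.
    apply: exec_loop => k kn; first by decide_regs; lia.
    apply: exec_eq.
      by apply: IHc => y by_; decide_regs; apply: r0; lia.
    by rewrite /st; regs.
  by apply: exec_eq; [apply: exec_move; lia | rewrite /st; regs].
Qed.

(** * Machines that search for their output values *)

(** Register 0 holds the number n of entries output so far, register 1 the code
    of the list, last entry first, of the input entries read so far. A value
    v.+1 of c at this pair makes v the next output; the value 0 asks for one
    more input entry. Register 3 is a flag for the second case. *)
Definition search_body (c : pr_code) : cmd :=
  (copy_reg 0 2 4 ;; copy_reg 1 3 4 ;; pairing 2 ;; cmd_of c 2 ;; Inc 3 ;;
   Loop 2 (clear_reg 3 ;; Loop 2 (Emit true) ;; Emit false ;; Inc 0) ;;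
   Loop 3 (Read 2 ;; move_reg 1 3 ;; pairing 2 ;; move_reg 2 1 ;; Inc 1))%cmd.

Definition search_regs (n k : nat) : nat -> nat :=
  fun y => if y == 0 then n else if y == 1 then k else 0.

Definition search_store (p : baire) (n w : nat) (o : seq bool) : store :=
  (search_regs n (seq_code (rev (mkseq p w))), (w, o)).

Lemma exec_search_body p c n w o v :
  eval_code c (npair n (seq_code (rev (mkseq p w)))) = v ->
  exec_cmd p (search_body c) (search_store p n w o)
    (if v is v'.+1 then search_store p n.+1 w (o ++ rcons (nseq v' true) false)
     else search_store p n w.+1 o).
Proof.
rewrite /search_store; set k := seq_code _ => Ev.
have [r rE] : exists r, r = search_regs n k by eexists.
have [rn rk] : r 0 = n /\ r 1 = k by rewrite rE.
have r0 y : 1 < y -> r y = 0 by rewrite rE; case: y => [|[]].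
have [r2 r3 r4 r5] : [/\ r 2 = 0, r 3 = 0, r 4 = 0 & r 5 = 0] by split; apply: r0.
rewrite -rE; apply: ExecSeq; first exact: exec_copy.
apply: ExecSeq; first by apply: exec_copy.
apply: ExecSeq; first by apply: exec_pairing.
apply: (@ExecSeq _ _ _ _ (upd r 2 v, (w, o))).
  apply: exec_eq; first by apply: exec_cmd_of => y y2; decide_regs; rewrite ?r0; lia.
  rewrite -Ev; regs; by rewrite r2 r3 rn rk.
apply: ExecSeq; first exact: ExecInc.
case: v Ev => [|v] _.
  apply: ExecSeq; first by apply: ExecLoop0.
  apply: ExecLoopS; first by decide_regs.
    apply: ExecSeq; first exact: ExecRead.
    apply: ExecSeq; first by apply: exec_move; lia.
    apply: ExecSeq; first by apply: exec_pairing; decide_regs.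
    apply: ExecSeq; first by apply: exec_move; lia.
    exact: ExecInc.
  apply: exec_eq; first by apply: ExecLoop0; decide_regs.
  congr pair; apply/funext => y; rewrite mkseqS rev_rcons [seq_code _]/= -/k.
  case: y => [|[|[|[|y]]]]; rewrite /search_regs /upd /= ?rn ?rk ?r2 ?r3 ?r0 //.
apply: (@ExecSeq _ _ _ _ (search_store p n.+1 w (o ++ rcons (nseq v true) false))).
  apply: ExecLoopS; first by decide_regs.
    apply: ExecSeq; first exact: exec_clear.
    set st := fun j => (upd r 2 (v - j), (w, o ++ nseq j true)) : store.
    apply: (@ExecSeq _ _ _ _ (st v)).
      set s0 := (X in exec_cmd _ _ X _).
      have -> : s0 = st 0 by rewrite /s0 /st cats0; regs.
      apply: exec_loop => j jv; first by decide_regs.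
      rewrite /st; apply: exec_eq; first exact: ExecEmit.
      rewrite -cats1 -catA -[[:: true]]/(nseq 1 true) -nseqD addn1.
      by regs.
    apply: ExecSeq; first exact: ExecEmit.
    exact: ExecInc.
  apply: exec_eq; first by apply: ExecLoop0; decide_regs; lia.
  rewrite /search_store -/k -rcons_cat; congr pair; apply/funext => y.
  case: y => [|[|[|[|y]]]];
    by rewrite /search_regs /upd /= ?rn ?rk ?r2 ?r3 ?r0 ?subnn.
by rewrite /search_store -/k; apply: ExecLoop0.
Qed.

Definition search_program (c : pr_code) : program :=
  compile 0 (search_body c) ++ [:: Test 0 0 0 0].

Lemma represents_init p : represents p init_config (search_store p 0 0 [::]).
Proof. by split=> // x; exists 0; case: x => [|[]]. Qed.

(** Entries once read are kept when the next output is searched for, so the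
    first value found for an output may come from a prefix that is longer than
    needed. This is why c has to be correct on all prefixes and defined on all
    long ones. *)
Lemma search_program_correct c (p q : baire) :
  (forall n w v, eval_code c (npair n (seq_code (rev (mkseq p w)))) = v.+1 ->
    v = q n) ->
  (forall n, exists w0, forall w, w0 <= w ->
    0 < eval_code c (npair n (seq_code (rev (mkseq p w))))) ->
  computes (search_program c) p q.
Proof.
set P := search_program c; move=> sound total.
pose reached n w := exists2 d, reaches P p init_config d &
  state d = 0 /\ represents p d (search_store p n w (tape_prefix q n)).
pose val n w := eval_code c (npair n (seq_code (rev (mkseq p w)))).
have body n w : reached n w ->
      if val n w is 0 then reached n w.+1 else reached n.+1 w.
  move=> [d hd [d0 rd]].
  have ld : loaded P 0 (compile 0 (search_body c)).
    exact: (@loaded_catl P 0 _ [:: Test 0 0 0 0]).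
  have := @exec_search_body p c n w (tape_prefix q n) _ erefl.
  move/(compile_correct (P := P))/(_ 0 ld d d0 rd) => [e [he e0 re]].
  have jump : reaches P p init_config (Config 0 (in_pos e) (work e) (out e)).
    apply: reaches_trans hd (reaches_trans he _).
    apply: (reaches_step (ins := Test 0 0 0 0)).
      rewrite e0 /P /search_program onth_cat size_compile ltnn subnn //.
    by case: (e) => s h t o /=; rewrite if_same; apply: reaches_refl.
  rewrite -/(val n w) in re.
  case Ev: (val n w) re => [|v] re; eexists; try exact: jump.
    by split=> //; case: re.
  split=> //; rewrite tape_prefixS -(sound _ _ _ Ev).
  by case: re.
have all n : exists w, reached n w.
  elim: n => [|n [w rw]].
    exists 0, init_config; first exact: reaches_refl.
    by split=> //; exact: represents_init.
  have [w0 tw0] := total n.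
  have [k] : exists k, w0 - w = k by eexists.
  elim: k w rw => [|k IHk] w rw wk; last first.
    move: (body _ _ rw); case: (val n w) => [rw1|v rw1]; last by exists w.
    by apply: (IHk _ rw1); lia.
  have lew : w0 <= w by lia.
  exists w; move: (body _ _ rw) (tw0 w lew); rewrite -/(val n w).
  by case: (val n w).
move=> n; have [w [d [t <-] [_ [_ _ /= od]]]] := all n.
by exists t; rewrite /run od prefix_refl.
Qed.

(** * Primitive recursion on encoded data *)

(** The codes of pairs and of lists are those of [npair] and [seq_code], so that
    the covers and programs that are given by their codes are decoded by the
    identity on codes. *)
Class encoding (A : Type) : Type := encode : A -> nat.

#[global] Instance encoding_nat : encoding nat := id.
#[global] Instance encoding_bool : encoding bool := nat_of_bool.
#[global] Instance encoding_pair A B `{encoding A} `{encoding B} :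
  encoding (A * B) := fun z => npair (encode z.1) (encode z.2).
#[global] Instance encoding_seq A `{encoding A} : encoding (seq A) :=
  fun s => seq_code (map encode s).
#[global] Instance encoding_option A `{encoding A} : encoding (option A) :=
  fun o => if o is Some a then (encode a).+1 else 0.

Definition primrec A B `{encoding A} `{encoding B} (f : A -> B) : Prop :=
  exists c, forall a, eval_code c (encode a) = encode (f a).

Lemma of_natK m n : Cantor.of_nat (npair m n) = (m, n).
Proof. exact: Cantor.cancel_of_to. Qed.

Lemma encode_cons A `{encoding A} (a : A) s :
  encode (a :: s) = (npair (encode a) (encode s)).+1.
Proof. by []. Qed.

Section Basic.
Context {T A B C : Type} `{encoding T} `{encoding A} `{encoding B} `{encoding C}.

(** Changing the type of a value without changing its code is free; most of the
    decoding functions below are of this kind. *)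
Lemma primrec_cast (f : T -> A) (g : T -> B) :
  primrec f -> (forall x, encode (f x) = encode (g x)) -> primrec g.
Proof. by move=> [c cf] fg; exists c => x; rewrite cf. Qed.

Lemma primrec_eq (f g : T -> A) : primrec f -> f =1 g -> primrec g.
Proof. by move=> [c cf] fg; exists c => x; rewrite cf fg. Qed.

Lemma primrec_id : primrec (fun x : T => x).
Proof. by exists CId. Qed.

Lemma primrec_comp (g : A -> B) (f : T -> A) :
  primrec g -> primrec f -> primrec (fun x => g (f x)).
Proof. by move=> [c cg] [d df]; exists (CComp c d) => x; rewrite /= df cg. Qed.

Lemma primrec_const (a : A) : primrec (fun _ : T => a).
Proof.
exists (iter (encode a) (CComp CSucc) CZero) => x.
by elim: (encode a) => //= n ->.
Qed.

Lemma primrec_pair (f : T -> A) (g : T -> B) :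
  primrec f -> primrec g -> primrec (fun x => (f x, g x)).
Proof. by move=> [c cf] [d dg]; exists (CPair c d) => x; rewrite /= cf dg. Qed.

Lemma primrec_fst (f : T -> A * B) : primrec f -> primrec (fun x => (f x).1).
Proof.
by move=> [c cf]; exists (CComp CFst c) => x; rewrite /= cf of_natK.
Qed.

Lemma primrec_snd (f : T -> A * B) : primrec f -> primrec (fun x => (f x).2).
Proof.
by move=> [c cf]; exists (CComp CSnd c) => x; rewrite /= cf of_natK.
Qed.

Lemma primrec_succ (f : T -> nat) : primrec f -> primrec (fun x => (f x).+1).
Proof. by move=> [c cf]; exists (CComp CSucc c) => x; rewrite /= cf. Qed.

Lemma primrec_eval c (f : T -> nat) :
  primrec f -> primrec (fun x => eval_code c (f x)).
Proof. by move=> [d df]; exists (CComp c d) => x; rewrite /= df. Qed.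

End Basic.

Section Pairing.
Context {T A : Type} `{encoding T} `{encoding A}.

Lemma primrec_of_nat (f : T -> nat) :
  primrec f -> primrec (fun x => Cantor.of_nat (f x)).
Proof.
move=> pf; apply: (primrec_cast pf) => x.
rewrite {2}/encode /encoding_pair /npair -surjective_pairing.
by rewrite Cantor.cancel_to_of.
Qed.

Lemma primrec_npair (f g : T -> nat) :
  primrec f -> primrec g -> primrec (fun x => npair (f x) (g x)).
Proof.
by move=> pf pg; apply: (primrec_cast (primrec_pair pf pg)).
Qed.

Lemma primrec_encode (f : T -> A) : primrec f -> primrec (fun x => encode (f x)).
Proof. by move=> pf; apply: (primrec_cast pf). Qed.

Lemma primrec_iter (n : T -> nat) (f : T -> A -> A) (a : T -> A) :
  primrec n -> primrec (fun z : T * A => f z.1 z.2) -> primrec a ->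
  primrec (fun x => iter (n x) (f x) (a x)).
Proof.
move=> [cn nE] [cf fE] [ca aE].
exists (CComp CSnd (CComp (CIter (CPair CFst cf)) (CPair cn (CPair CId ca)))) => x.
rewrite /= of_natK nE aE; set z := iter _ _ _.
have -> : z = encode (x, iter (n x) (f x) (a x)); last by rewrite of_natK.
rewrite /z [encode (n x)]/encode /encoding_nat; elim: (n x) => [|k IHk] //=.
by rewrite IHk fE of_natK.
Qed.

End Pairing.

Section Composition.
Context {T A B C D : Type}.
Context `{encoding T} `{encoding A} `{encoding B} `{encoding C} `{encoding D}.

Lemma primrec_comp2 (f : A -> B -> C) (a : T -> A) (b : T -> B) :
  primrec (fun z : A * B => f z.1 z.2) -> primrec a -> primrec b ->
  primrec (fun x => f (a x) (b x)).
Proof. by move=> pf pa pb; exact: primrec_comp pf (primrec_pair pa pb). Qed.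

Lemma primrec_comp3 (f : A -> B -> C -> D) (a : T -> A) (b : T -> B)
    (c : T -> C) :
  primrec (fun z : A * (B * C) => f z.1 z.2.1 z.2.2) ->
  primrec a -> primrec b -> primrec c -> primrec (fun x => f (a x) (b x) (c x)).
Proof.
move=> pf pa pb pc.
exact: primrec_comp pf (primrec_pair pa (primrec_pair pb pc)).
Qed.

End Composition.

(** Hooks of [primrec_tac], redefined below once the closure properties that
    they apply are proved. *)
Ltac primrec_cases := fail.
Ltac primrec_folds := fail.
Ltac primrec_arith := fail.
Ltac primrec_lists := fail.
Ltac primrec_user := fail.
Ltac primrec_step := first
  [ assumption
  | simple apply primrec_const
  | simple apply primrec_id
  | simple apply primrec_fst
  | simple apply primrec_snd
  | simple apply primrec_pair
  | simple apply primrec_succ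
  | primrec_cases
  | primrec_folds
  | primrec_arith
  | primrec_lists
  | primrec_user
  | match goal with h : primrec _ |- _ => first
      [ apply (primrec_comp2 h)
      | apply (primrec_comp3 h)
      | apply (primrec_comp h) ]
    end ].
(** Proves that a function is primitive recursive by recursion on its syntax. *)
Ltac primrec_tac := repeat (primrec_step; cbn beta).

Section Conditionals.
Context {T A B : Type} `{encoding T} `{encoding A} `{encoding B}.

Lemma primrec_if (b : T -> bool) (f g : T -> A) :
  primrec b -> primrec f -> primrec g ->
  primrec (fun x => if b x then f x else g x).
Proof.
move=> pb pf pg.
have h : primrec (fun x => (iter (encode (b x)) (fun s : A * A => (s.2, s.2))
    (g x, f x)).1).
  apply: primrec_fst; apply: primrec_iter; first exact: primrec_encode.
    by primrec_tac.
  by primrec_tac.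
by apply: (primrec_eq h) => x; case: (b x).
Qed.

Lemma primrec_pred (n : T -> nat) : primrec n -> primrec (fun x => (n x).-1).
Proof.
move=> pn.
have h : primrec (fun x => (iter (n x) (fun s => (s.1.+1, s.1)) (0, 0)).2).
  by apply: primrec_snd; apply: primrec_iter => //; primrec_tac.
apply: (primrec_eq h) => x; case: (n x) => //= k.
by elim: k => //= k ->.
Qed.

Lemma primrec_is_zero (n : T -> nat) : primrec n -> primrec (fun x => n x == 0).
Proof.
move=> pn.
have h : primrec (fun x => iter (n x) (fun _ => false) true).
  by apply: primrec_iter => //; primrec_tac.
by apply: (primrec_eq h) => x; case: (n x).
Qed.

End Conditionals.

Section Cases.
Context {T A B : Type} `{encoding T} `{encoding A} `{encoding B}.

(** A case analysis acts on codes: options and lists have code 0 in the first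
    case and m.+1 in the second, where m codes the arguments. *)
Lemma primrec_case_code (c d e : pr_code) :
  exists c', forall z, eval_code c' z =
    if eval_code c z is m.+1 then eval_code d (npair z m) else eval_code e z.
Proof.

have pe c' : primrec (eval_code c') by exists c'.
have h : primrec (fun z => if eval_code c z == 0 then eval_code e z
    else eval_code d (npair z (eval_code c z).-1)).
  apply: primrec_if; [exact: primrec_is_zero | exact: pe |].
  apply: primrec_eval; apply: primrec_npair; first exact: primrec_id.
  exact: primrec_pred.
have [c' c'E] := h; exists c' => z; apply: (etrans (c'E z)).
by case: (eval_code c z).
Qed.

Lemma primrec_option (o : T -> option A) (f : T -> A -> B) (g : T -> B) :
  primrec o -> primrec (fun z : T * A => f z.1 z.2) -> primrec g ->
  primrec (fun x => match o x with Some a => f x a | None => g x end).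
Proof.
move=> [co oE] [cf fE] [cg gE]; have [c cE] := primrec_case_code co cf cg.
exists c => x; rewrite cE oE; case: (o x) => [a|] /=; last exact: gE.
exact: (fE (x, a)).
Qed.

Lemma primrec_list (l : T -> seq A) (f : T -> A -> seq A -> B) (g : T -> B) :
  primrec l -> primrec (fun z : T * (A * seq A) => f z.1 z.2.1 z.2.2) ->
  primrec g ->
  primrec (fun x => match l x with [::] => g x | a :: s => f x a s end).
Proof.
move=> [cl lE] [cf fE] [cg gE]; have [c cE] := primrec_case_code cl cf cg.
exists c => x; rewrite cE lE; case: (l x) => [|a s] /=; first exact: gE.
exact: (fE (x, (a, s))).
Qed.

Lemma primrec_Some (f : T -> A) : primrec f -> primrec (fun x => Some (f x)).
Proof.
by move=> pf; apply: (primrec_cast (primrec_succ (primrec_encode pf))).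
Qed.

Lemma primrec_cons (f : T -> A) (g : T -> seq A) :
  primrec f -> primrec g -> primrec (fun x => f x :: g x).
Proof.
move=> pf pg.
exact: (primrec_cast (primrec_succ (primrec_encode (primrec_pair pf pg)))).
Qed.

End Cases.

Ltac primrec_cases ::= first
  [ simple apply primrec_if
  | simple apply primrec_pred
  | simple apply primrec_is_zero
  | simple apply primrec_option
  | simple apply primrec_list
  | simple apply primrec_Some
  | simple apply primrec_cons
  | simple apply primrec_of_nat
  | simple apply primrec_npair
  | simple apply primrec_iter ].

Lemma size_leq_encode A `{encoding A} (s : seq A) : size s <= encode s.
Proof.
elim: s => //= a s IHs; rewrite encode_cons ltnS npairE.
by apply: leq_trans IHs _; rewrite leq_addr.
Qed.

Section Lists.
Context {T A B : Type} `{encoding T} `{encoding A} `{encoding B}.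

(** The code of a list bounds its length, so that iterating the treatment of one
    entry that many times exhausts the list. *)
Lemma primrec_foldl (f : T -> B -> A -> B) (b : T -> B) (l : T -> seq A) :
  primrec (fun z : T * (B * A) => f z.1 z.2.1 z.2.2) -> primrec b -> primrec l ->
  primrec (fun x => foldl (f x) (b x) (l x)).
Proof.
move=> pf pb pl.
pose next x (st : B * seq A) :=
  match st.2 with [::] => st | a :: s => (f x st.1 a, s) end.
have h : primrec (fun x => (iter (encode (l x)) (next x) (b x, l x)).1).
  apply: primrec_fst; apply: primrec_iter; first exact: primrec_encode.
    by rewrite /next; primrec_tac.
  by primrec_tac.
apply: (primrec_eq h) => x.
have stop c k : iter k (next x) (c, [::]) = (c, [::]) by elim: k => //= k ->.
have : size (l x) <= encode (l x) by exact: size_leq_encode.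
move: (encode (l x)) (b x).
elim: (l x) => [|a s IHs] n b' sn; first by rewrite stop.
case: n sn => [|n]; first by rewrite /= ltn0.
by move=> sn; rewrite iterSr IHs.
Qed.

End Lists.

Section Folds.
Context {T A B : Type} `{encoding T} `{encoding A} `{encoding B}.

Lemma primrec_rev (l : T -> seq A) : primrec l -> primrec (fun x => rev (l x)).
Proof.
move=> pl.
have h : primrec (fun x => foldl (fun s a => a :: s) [::] (l x)).
  by apply: primrec_foldl => //; primrec_tac.
apply: (primrec_eq h) => x; rewrite -[RHS]cats0 -catrevE.
by elim: (l x) [::] => //= a s IHs t; rewrite IHs.
Qed.

Lemma primrec_foldr (f : T -> A -> B -> B) (b : T -> B) (l : T -> seq A) :
  primrec (fun z : T * (B * A) => f z.1 z.2.2 z.2.1) -> primrec b -> primrec l ->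
  primrec (fun x => foldr (f x) (b x) (l x)).
Proof.
move=> pf pb pl.
have h : primrec (fun x => foldl (fun c a => f x a c) (b x) (rev (l x))).
  by apply: primrec_foldl => //; apply: primrec_rev.
by apply: (primrec_eq h) => x; rewrite foldl_rev.
Qed.

End Folds.

Ltac primrec_folds ::= first
  [ simple apply primrec_foldl
  | simple apply primrec_foldr
  | simple apply primrec_rev ].

Section Addition.
Context {T : Type} `{encoding T}.
Implicit Types (m n : T -> nat) (a b : T -> bool).

Lemma primrec_addn m n : primrec m -> primrec n -> primrec (fun x => m x + n x).
Proof.
move=> pm pn; have h : primrec (fun x => iter (m x) S (n x)) by primrec_tac.
by apply: (primrec_eq h) => x; rewrite iter_succn addnC.
Qed.

Lemma primrec_subn m n : primrec m -> primrec n -> primrec (fun x => m x - n x).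
Proof.
move=> pm pn; have h : primrec (fun x => iter (n x) predn (m x)) by primrec_tac.
by apply: (primrec_eq h) => x; rewrite iter_predn.
Qed.

Lemma primrec_leq m n : primrec m -> primrec n -> primrec (fun x => m x <= n x).
Proof. by move=> pm pn; apply/primrec_is_zero/primrec_subn. Qed.

Lemma primrec_and a b : primrec a -> primrec b -> primrec (fun x => a x && b x).
Proof. by move=> pa pb; apply: primrec_if => //; apply: primrec_const. Qed.

Lemma primrec_or a b : primrec a -> primrec b -> primrec (fun x => a x || b x).
Proof. by move=> pa pb; apply: primrec_if => //; apply: primrec_const. Qed.

Lemma primrec_neg a : primrec a -> primrec (fun x => ~~ a x).
Proof. by move=> pa; apply: primrec_if => //; apply: primrec_const. Qed.

End Addition.

Ltac primrec_arith ::= first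
  [ simple apply primrec_addn
  | simple apply primrec_subn
  | simple apply primrec_leq
  | simple apply primrec_and
  | simple apply primrec_or
  | simple apply primrec_neg ].

Section Multiplication.
Context {T : Type} `{encoding T}.
Implicit Types (m n : T -> nat).

Lemma primrec_muln m n : primrec m -> primrec n -> primrec (fun x => m x * n x).
Proof.
move=> pm pn; have h : primrec (fun x => iter (m x) (addn (n x)) 0).
  by primrec_tac.
by apply: (primrec_eq h) => x; rewrite iter_addn_0 mulnC.
Qed.

Lemma primrec_eqn m n : primrec m -> primrec n -> primrec (fun x => m x == n x).
Proof.
move=> pm pn; have h : primrec (fun x => (m x <= n x) && (n x <= m x)).
  by primrec_tac.
by apply: (primrec_eq h) => x; rewrite -eqn_leq.
Qed.

End Multiplication.

Ltac primrec_arith ::= first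
  [ simple apply primrec_addn
  | simple apply primrec_subn
  | simple apply primrec_muln
  | simple apply primrec_leq
  | simple apply primrec_eqn
  | simple apply primrec_and
  | simple apply primrec_or
  | simple apply primrec_neg ].

Section ListFunctions.
Context {T A B : Type} `{encoding T} `{encoding A} `{encoding B}.
Implicit Types l : T -> seq A.

Lemma primrec_expn (m n : T -> nat) :
  primrec m -> primrec n -> primrec (fun x => m x ^ n x).
Proof.
move=> pm pn; have h : primrec (fun x => iter (n x) (muln (m x)) 1).
  by primrec_tac.
by apply: (primrec_eq h) => x; rewrite iter_muln_1.
Qed.

Lemma primrec_cat (s t : T -> seq A) :
  primrec s -> primrec t -> primrec (fun x => s x ++ t x).
Proof.
move=> ps pt; have h : primrec (fun x => foldr cons (t x) (s x)) by primrec_tac.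
by apply: (primrec_eq h) => x; elim: (s x) => //= a u ->.
Qed.

Lemma primrec_size l : primrec l -> primrec (fun x => size (l x)).
Proof.
move=> pl; have h : primrec (fun x => foldr (fun _ => S) 0 (l x)) by primrec_tac.
by apply: (primrec_eq h) => x; elim: (l x) => //= a u ->.
Qed.

Lemma primrec_head (a : T -> A) l :
  primrec a -> primrec l -> primrec (fun x => head (a x) (l x)).
Proof.
move=> pa pl.
have h : primrec (fun x => match l x with [::] => a x | b :: s => b end).
  by primrec_tac.
by apply: (primrec_eq h).
Qed.

Lemma primrec_ohead l : primrec l -> primrec (fun x => ohead (l x)).
Proof.
move=> pl.
have h : primrec (fun x => match l x with [::] => None | b :: s => Some b end).
  by primrec_tac.
by apply: (primrec_eq h).
Qed.

Lemma primrec_behead l : primrec l -> primrec (fun x => behead (l x)).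
Proof.
move=> pl.
have h : primrec (fun x => match l x with [::] => [::] | b :: s => s end).
  by primrec_tac.
by apply: (primrec_eq h).
Qed.

Lemma primrec_map (f : T -> A -> B) l :
  primrec (fun z : T * A => f z.1 z.2) -> primrec l ->
  primrec (fun x => map (f x) (l x)).
Proof.
move=> pf pl; have h : primrec (fun x => foldr (fun a s => f x a :: s) [::] (l x)).
  by primrec_tac.
by apply: (primrec_eq h) => x; elim: (l x) => //= a u ->.
Qed.

Lemma primrec_pmap (f : T -> A -> option B) l :
  primrec (fun z : T * A => f z.1 z.2) -> primrec l ->
  primrec (fun x => pmap (f x) (l x)).
Proof.
move=> pf pl; have h : primrec (fun x => foldr (fun a s =>
    match f x a with Some b => b :: s | None => s end) [::] (l x)).
  by primrec_tac.
by apply: (primrec_eq h) => x; elim: (l x) => //= a u ->; case: (f x a).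
Qed.

Lemma primrec_filter (f : T -> A -> bool) l :
  primrec (fun z : T * A => f z.1 z.2) -> primrec l ->
  primrec (fun x => [seq a <- l x | f x a]).
Proof.
move=> pf pl; have h : primrec (fun x => foldr (fun a s =>
    if f x a then a :: s else s) [::] (l x)).
  by primrec_tac.
by apply: (primrec_eq h) => x; elim: (l x) => //= a u ->.
Qed.

Lemma primrec_find (f : T -> A -> bool) l :
  primrec (fun z : T * A => f z.1 z.2) -> primrec l ->
  primrec (fun x => find (f x) (l x)).
Proof.
move=> pf pl; have h : primrec (fun x => foldr (fun a n =>
    if f x a then 0 else n.+1) 0 (l x)).
  by primrec_tac.
by apply: (primrec_eq h) => x; elim: (l x) => //= a u ->.
Qed.

Lemma primrec_has (f : T -> A -> bool) l :
  primrec (fun z : T * A => f z.1 z.2) -> primrec l ->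
  primrec (fun x => has (f x) (l x)).
Proof.
move=> pf pl; have h : primrec (fun x => foldr (fun a b => f x a || b) false (l x)).
  by primrec_tac.
by apply: (primrec_eq h) => x; elim: (l x) => //= a u ->.
Qed.

Lemma primrec_all (f : T -> A -> bool) l :
  primrec (fun z : T * A => f z.1 z.2) -> primrec l ->
  primrec (fun x => all (f x) (l x)).
Proof.
move=> pf pl; have h : primrec (fun x => foldr (fun a b => f x a && b) true (l x)).
  by primrec_tac.
by apply: (primrec_eq h) => x; elim: (l x) => //= a u ->.
Qed.

Lemma primrec_nseq (n : T -> nat) (a : T -> A) :
  primrec n -> primrec a -> primrec (fun x => nseq (n x) (a x)).
Proof. by move=> pn pa; rewrite /nseq /ncons; primrec_tac. Qed.

End ListFunctions.

Ltac primrec_lists ::= first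
  [ simple apply primrec_expn
  | simple apply primrec_cat
  | simple apply primrec_size
  | simple apply primrec_head
  | simple apply primrec_ohead
  | simple apply primrec_behead
  | simple apply primrec_map
  | simple apply primrec_pmap
  | simple apply primrec_filter
  | simple apply primrec_find
  | simple apply primrec_has
  | simple apply primrec_all
  | simple apply primrec_nseq ].

Section Indexing.
Context {T A : Type} `{encoding T} `{encoding A}.
Implicit Types (n : T -> nat) (l : T -> seq A).

Lemma primrec_drop n l :
  primrec n -> primrec l -> primrec (fun x => drop (n x) (l x)).
Proof.
move=> pn pl; have h : primrec (fun x => iter (n x) behead (l x)).
  by primrec_tac.
by apply: (primrec_eq h) => x; rewrite drop_behead.
Qed.

Lemma primrec_nth (a : T -> A) l n :
  primrec a -> primrec l -> primrec n -> primrec (fun x => nth (a x) (l x) (n x)).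
Proof.
move=> pa pl pn; have h : primrec (fun x => head (a x) (drop (n x) (l x))).
  by apply: primrec_head => //; apply: primrec_drop.
by apply: (primrec_eq h) => x; rewrite -nth0 nth_drop addn0.
Qed.

Lemma primrec_onth l n :
  primrec l -> primrec n -> primrec (fun x => onth (l x) (n x)).
Proof.
move=> pl pn; have h : primrec (fun x => ohead (drop (n x) (l x))).
  by apply: primrec_ohead => //; apply: primrec_drop.
apply: (primrec_eq h) => x; elim: (l x) (n x) => [|a s IHs] [|m] //=.
Qed.

Lemma primrec_take n l :
  primrec n -> primrec l -> primrec (fun x => take (n x) (l x)).
Proof.
move=> pn pl.
have h : primrec (fun x => rev (drop (size (l x) - n x) (rev (l x)))).
  by apply: primrec_rev; apply: primrec_drop; primrec_tac.
by apply: (primrec_eq h) => x; rewrite -{3}[l x]revK take_rev size_rev.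
Qed.

Lemma primrec_iota (m n : T -> nat) :
  primrec m -> primrec n -> primrec (fun x => iota (m x) (n x)).
Proof.
move=> pm pn.
have h : primrec (fun x => iter (n x) (fun s => s ++ [:: m x + size s]) [::]).
  by primrec_tac.
apply: (primrec_eq h) => x; elim: (n x) => // k IHk.
by rewrite iterS IHk size_iota -addn1 iotaD.
Qed.

Lemma primrec_mem (a : T -> nat) (s : T -> seq nat) :
  primrec a -> primrec s -> primrec (fun x => a x \in s x).
Proof.
move=> pa ps; have h : primrec (fun x => has (fun b => b == a x) (s x)).
  by primrec_tac.
by apply: (primrec_eq h) => x; rewrite has_pred1.
Qed.

Lemma primrec_isSome (o : T -> option A) :
  primrec o -> primrec (fun x => isSome (o x)).
Proof.
move=> po.
have h : primrec (fun x => match o x with Some _ => true | None => false end).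
  by primrec_tac.
by apply: (primrec_eq h) => x; case: (o x).
Qed.

End Indexing.

Section Flatten.
Context {T A : Type} `{encoding T} `{encoding A}.

Lemma primrec_flatten (l : T -> seq (seq A)) :
  primrec l -> primrec (fun x => flatten (l x)).
Proof. by move=> pl; rewrite /flatten; primrec_tac. Qed.

End Flatten.

Ltac primrec_lists ::= first
  [ simple apply primrec_expn
  | simple apply primrec_cat
  | simple apply primrec_size
  | simple apply primrec_head
  | simple apply primrec_ohead
  | simple apply primrec_behead
  | simple apply primrec_map
  | simple apply primrec_pmap
  | simple apply primrec_filter
  | simple apply primrec_find
  | simple apply primrec_has
  | simple apply primrec_all
  | simple apply primrec_nseq
  | simple apply primrec_drop
  | simple apply primrec_nth
  | simple apply primrec_onth
  | simple apply primrec_take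
  | simple apply primrec_iota
  | simple apply primrec_mem
  | simple apply primrec_isSome
  | simple apply primrec_flatten ].

(** * A primitive recursive universal machine *)

(** The first argument is fuel; the code itself is enough. *)
Fixpoint seq_decode_fuel (k n : nat) : seq nat :=
  if k is k'.+1 then
    if n is m.+1 then
      (Cantor.of_nat m).1 :: seq_decode_fuel k' (Cantor.of_nat m).2
    else [::]
  else [::].

Definition seq_decode (n : nat) : seq nat := seq_decode_fuel n n.

Lemma seq_decodeK : cancel seq_decode seq_code.
Proof.
suff h k n : n <= k -> seq_code (seq_decode_fuel k n) = n by move=> n; exact: h.
elim: k n => [|k IHk] [|n] //= nk; have := Cantor.cancel_to_of n.
case: (Cantor.of_nat n) => a b /= ab; rewrite IHk ?[npair _ _]ab //.
have : n = b + tri (b + a) by rewrite -ab.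
by lia.
Qed.

Lemma seq_codeK : cancel seq_code seq_decode.
Proof. by move=> s; apply: seq_code_inj; rewrite seq_decodeK. Qed.

Lemma primrec_seq_decode T `{encoding T} (f : T -> nat) :
  primrec f -> primrec (fun x => seq_decode (f x)).
Proof.
move=> pf; apply: (primrec_cast pf) => x.
by rewrite {2}/encode /encoding_seq map_id seq_decodeK.
Qed.

Definition pi1 (n : nat) : nat := (Cantor.of_nat n).1.
Definition pi2 (n : nat) : nat := (Cantor.of_nat n).2.

Lemma pi1K m n : pi1 (npair m n) = m.
Proof. by rewrite /pi1 of_natK. Qed.

Lemma pi2K m n : pi2 (npair m n) = n.
Proof. by rewrite /pi2 of_natK. Qed.

(** Every number is read as an instruction, so that the universal machine below
    is total. *)
Definition decode_instr (c : nat) : instr :=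
  let a := pi2 c in
  match pi1 c with
  | 0 => GoLeft (pi1 a) (pi2 a)
  | 1 => GoRight (pi1 a) (pi2 a)
  | 2 => Write (pi1 a) (pi1 (pi2 a)) (pi2 (pi2 a))
  | 3 => Test (pi1 a) (pi1 (pi2 a)) (pi1 (pi2 (pi2 a))) (pi2 (pi2 (pi2 a)))
  | 4 => InNext a
  | 5 => InTest (pi1 a) (pi2 a)
  | _ => Output (pi1 a != 0) (pi2 a)
  end.

Lemma instr_codeK : cancel instr_code decode_instr.
Proof.
by case=> [i s|i s|i a s|i a s s'|s|s s'|b s];
  rewrite /decode_instr /instr_code !(pi1K, pi2K) //; case: b.
Qed.

Definition decode_program (n : nat) : program :=
  map decode_instr (seq_decode n).

Lemma program_codeK : cancel program_code decode_program.
Proof. by move=> P; rewrite /decode_program seq_codeK (mapK instr_codeK). Qed.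

(** The work tapes are given by the list of all updates, latest first; an update
    is then a mere [cons], and no infinite object has to be coded. *)
Definition history : Type := seq (nat * (seq nat * seq nat)).
Definition hconfig : Type := (nat * (nat * (history * seq bool)))%type.

Definition lookup (w : history) (i : nat) : tape :=
  head ([::], [::]) (pmap (fun z => if z.1 == i then Some z.2 else None) w).

Definition config_of (k : hconfig) : config :=
  Config k.1 k.2.1 (lookup k.2.2.1) k.2.2.2.

Lemma lookup_cons w i t : lookup ((i, t) :: w) = set_tape (lookup w) i t.
Proof.
by apply/funext => j; rewrite /lookup /set_tape /= eq_sym; case: eqP.
Qed.

Definition hexec (inp : seq bool) (c : nat) (k : hconfig) : hconfig :=
  let h := k.2.1 in let w := k.2.2.1 in let o := k.2.2.2 in
  let tag := pi1 c in let a := pi2 c in let i := pi1 a in let b := pi2 a in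
  if tag == 0 then (b, (h, ((i, tape_left (lookup w i)) :: w, o))) else
  if tag == 1 then (b, (h, ((i, tape_right (lookup w i)) :: w, o))) else
  if tag == 2 then
    (pi2 b, (h, ((i, tape_write (pi1 b) (lookup w i)) :: w, o))) else
  if tag == 3 then
    (if tape_read (lookup w i) == pi1 b then pi1 (pi2 b) else pi2 (pi2 b),
     (h, (w, o))) else
  if tag == 4 then (a, (h.+1, (w, o))) else
  if tag == 5 then (if nth false inp h then i else b, (h, (w, o))) else
  (b, (h, (w, o ++ [:: i != 0]))).

Lemma hexecE inp c k :
  config_of (hexec inp c k) =
  exec (nth false inp) (decode_instr c) (config_of k).
Proof.
case: k => s [h [w o]]; rewrite /config_of /hexec /decode_instr /=.
by case: (pi1 c) => [|[|[|[|[|[|t]]]]]]; rewrite //= ?lookup_cons ?cats1.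
Qed.

Definition hstep (C : seq nat) (inp : seq bool) (k : hconfig) : hconfig :=
  if onth C k.1 is Some c then hexec inp c k else k.

Definition hinit : hconfig := (0, (0, ([::], [::]))).

Lemma hrunE C inp t :
  config_of (iter t (hstep C inp) hinit) =
  run (map decode_instr C) (nth false inp) t.
Proof.
elim: t => // t; rewrite /run !iterS => <-.
rewrite {1}/hstep /step onth_map; case: onth => [c|] //=.
exact: hexecE.
Qed.

(** The state consists of the entries whose blocks are complete, last one first,
    and of the number of ones of the current block. *)
Definition parse_step (st : seq nat * nat) (b : bool) : seq nat * nat :=
  if b then (st.1, st.2.+1) else (st.2 :: st.1, 0).

Definition parse (o : seq bool) : seq nat :=
  rev (foldl parse_step ([::], 0) o).1.

Lemma parse_unary s : parse (unary s) = s.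
Proof.
suff h t : foldl parse_step (t, 0) (unary s) = (rev s ++ t, 0).
  by rewrite /parse h cats0 revK.
elim: s t => //= n s IHs t; rewrite /unary /= -/(unary s) foldl_cat.
have -> : foldl parse_step (t, 0) (rcons (nseq n true) false) = (n :: t, 0).
  rewrite -cats1 foldl_cat.
  suff -> m : foldl parse_step (t, m) (nseq n true) = (t, m + n) by [].
  by elim: n m => [|n IHn] m; rewrite ?addn0 //= IHn addSnnS.
by rewrite IHs rev_cons cat_rcons.
Qed.

Lemma parse_prefix o o' : prefix o o' -> prefix (parse o) (parse o').
Proof.
case/prefixP => e ->; rewrite /parse foldl_cat.
case: (foldl _ _ o) => s n; suff [u ->] : exists u,
    (foldl parse_step (s, n) e).1 = u ++ s.
  by rewrite rev_cat prefix_prefix.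
elim: e s n => [|[] e IHe] s n /=; first by exists [::].
  exact: IHe.
by have [u ->] := IHe (n :: s) 0; exists (rcons u n); rewrite cat_rcons.
Qed.

(** A machine reads at most one input symbol per step, and u is written with at
    least [size u] symbols. So these steps are the same on all the inputs that
    have the prefix u. *)
Definition output_prefix (n : nat) (u : seq nat) : seq nat :=
  parse (out (run (decode_program n) (nth false (unary u)) (size u))).

Lemma in_pos_run P inp t : in_pos (run P inp t) <= t.
Proof.
elim: t => // t; rewrite /run iterS -/(run P inp t) /step.
case: onth => [ins|]; last by move=> h; apply: leqW.
by case: (run P inp t) => s h w o; case: ins => //= *; lia.
Qed.

Lemma eq_run P inp inp' t :
  (forall j, j < t -> inp j = inp' j) -> run P inp t = run P inp' t.
Proof.
elim: t => // t IHt e; have := IHt (fun j jt => e j (ltnW jt)).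
rewrite /run !iterS -/(run P inp t) -/(run P inp' t) => <-.
rewrite /step; case: onth => // ins; have := in_pos_run P inp t.
case: (run P inp t) => s h w o /= ht.
by case: ins => //= s1 s2; rewrite e.
Qed.

Lemma output_prefix_run P p w : output_prefix (program_code P) (mkseq p w) =
  parse (out (run P (inscription p) w)).
Proof.
rewrite /output_prefix program_codeK size_mkseq; congr (parse (out _)).
apply: eq_run => j jw; rewrite (@inscriptionE p w) //.
by apply: leq_trans (leq_size_unary _); rewrite size_mkseq.
Qed.

Lemma mkseq_prefixP (q : nat -> nat) s n :
  prefix s (mkseq q n) -> s = mkseq q (size s).
Proof.
move=> sq; have sn : size s <= n by have := size_prefix sq; rewrite size_mkseq.
apply: (@eq_from_nth _ 0) => [|i is_]; first by rewrite size_mkseq.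
rewrite nth_mkseq // -(nth_prefix 0 sq is_) nth_mkseq //.
exact: leq_trans sn.
Qed.

Lemma output_prefix_sound n p q w : Phi n p q ->
  output_prefix n (mkseq p w) = mkseq q (size (output_prefix n (mkseq p w))).
Proof.
move=> [P <- cq]; rewrite output_prefix_run; set o := out _.
have [t qt] := cq (size o).+1.
apply: (@mkseq_prefixP _ _ (size o).+1); rewrite -[mkseq q _]parse_unary.
apply: parse_prefix; rewrite -/(tape_prefix q (size o).+1).
have [t' ot' qt'] : exists2 t', prefix o (out (run P (inscription p) t')) &
    prefix (tape_prefix q (size o).+1) (out (run P (inscription p) t')).
  exists (maxn w t).
    exact: (out_run_prefix P (inscription p) (leq_maxl w t)).
  exact: prefix_trans qt (out_run_prefix P (inscription p) (leq_maxr w t)).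
have os : size o <= size (tape_prefix q (size o).+1).
  by apply: leq_trans (leq_size_unary _); rewrite size_mkseq.
move: ot' qt'; rewrite ![prefix _ (out _)]prefixE => ot' /eqP qt'.
by rewrite prefixE -qt' take_takel.
Qed.

Lemma output_prefix_complete n p q k : Phi n p q ->
  exists w0, forall w, w0 <= w -> k < size (output_prefix n (mkseq p w)).
Proof.
move=> [P <- cq]; have [t qt] := cq k.+1; exists t => w tw.
rewrite output_prefix_run.
have := prefix_trans qt (out_run_prefix P (inscription p) tw).
by move/parse_prefix/size_prefix; rewrite parse_unary size_mkseq.
Qed.

Lemma primrec_lookup T `{encoding T} (w : T -> history) (i : T -> nat) :
  primrec w -> primrec i -> primrec (fun x => lookup (w x) (i x)).
Proof. by move=> pw pi; rewrite /lookup /tape; primrec_tac. Qed.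

Ltac primrec_user ::= first
  [ apply primrec_lookup | simple apply primrec_seq_decode ].

Lemma primrec_hstep T `{encoding T} (C : T -> seq nat)
    (inp : T -> seq bool) (k : T -> hconfig) :
  primrec C -> primrec inp -> primrec k ->
  primrec (fun x => hstep (C x) (inp x) (k x)).
Proof.
move=> pC pinp pk.
rewrite /hstep /hexec /tape_left /tape_right /tape_write /tape_read /pi1 /pi2.
rewrite /hconfig /history in pk *.
by primrec_tac.
Qed.

Lemma primrec_output_prefix T `{encoding T} (n : T -> nat) (u : T -> seq nat) :
  primrec n -> primrec u -> primrec (fun x => output_prefix (n x) (u x)).
Proof.
move=> pn pu.
pose k x := iter (size (u x)) (hstep (seq_decode (n x))
  (flatten [seq nseq m true ++ [:: false] | m <- u x])) hinit.
have pk : primrec k.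
  rewrite /k /hconfig /history.
  apply: primrec_iter; [by primrec_tac | | by primrec_tac].
  by apply: primrec_hstep; primrec_tac.
have h : primrec (fun x => rev (foldl parse_step ([::], 0) (k x).2.2.2).1).
  by rewrite /parse_step; primrec_tac.
apply: (primrec_eq h) => x; rewrite /output_prefix /decode_program -hrunE.
congr (rev (foldl _ _ (iter _ (hstep _ _) _).2.2.2).1).
by rewrite /unary; congr flatten; apply: eq_map => m; rewrite cats1.
Qed.

(** A Kleene normal form: a map given by primitive recursive approximations on
    the prefixes of its argument is computable. *)
Lemma primrec_machine (g : nat -> seq nat -> option nat) :
  primrec (fun z : nat * seq nat => g z.1 z.2) ->
  exists P : program, forall p q : baire,
    (forall n w v, g n (mkseq p w) = Some v -> v = q n) ->
    (forall n, exists w0, forall w, w0 <= w -> g n (mkseq p w)) ->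
    computes P p q.
Proof.
move=> pg.
have [c cE] : primrec (fun z : nat * seq nat => g z.1 (rev z.2)).
  by primrec_tac.
have eE n p w : eval_code c (npair n (seq_code (rev (mkseq p w)))) =
    encode (g n (mkseq p w)).
  have := cE (n, rev (mkseq p w)).
  by rewrite /= revK {1}/encode /encoding_pair /= {2}/encode /encoding_seq map_id.
exists (search_program c) => p q sound total; apply: search_program_correct.
  move=> n w v; rewrite eE; case e: (g n _) => [u|] // [<-].
  exact: sound e.
move=> n; have [w0 h] := total n; exists w0 => w /h.
by rewrite eE; case: (g n _).
Qed.

(** * Choices of balls and their rejection *)

(** The inequality nuQ r <= 2^-e, without denominators. *)
Definition radius_le (r e : nat) : bool :=
  pi1 r * 2 ^ e <= pi1 (pi2 r) * 2 ^ e + (pi2 (pi2 r)).+1.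

(** The inequality nuQ x > 2^-t + 2^-e, without denominators. *)
Definition value_gt (x t e : nat) : bool :=
  pi1 (pi2 x) * 2 ^ (t + e) + (pi2 (pi2 x)).+1 * (2 ^ t + 2 ^ e)
  < pi1 x * 2 ^ (t + e).

Definition decode_cover (n : nat) : seq (nat * nat) :=
  map Cantor.of_nat (seq_decode n).

Lemma cover_codeK : cancel cover_code decode_cover.
Proof.
move=> l; rewrite /decode_cover /cover_code seq_codeK -map_comp map_id_in //.
by move=> [a b] _ /=; rewrite of_natK.
Qed.

Lemma mkseq_const (i s : nat) : mkseq (fun _ => i) s = nseq s i.
Proof.
apply: (@eq_from_nth _ 0) => [|k]; rewrite size_mkseq ?size_nseq // => ks.
by rewrite nth_mkseq // nth_nseq ks.
Qed.

Section Effective.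
(* The codes of programs for the distance of X and for the compact sets K i. *)
Variables eD eK : nat.

Definition fine (j : nat) (l : seq (nat * nat)) : bool :=
  all (fun b => radius_le b.2 j.+2) l.

(** The first fine cover among the covers of K i that are enumerated in s steps;
    as the enumeration only grows, this does not depend on s once it exists. *)
Definition fine_cover (i s j : nat) : option (seq (nat * nat)) :=
  ohead [seq l <- map decode_cover (output_prefix eK (nseq s i)) | fine j l].

(** The bit at this address says whether ball k of the j-th fine cover of K i is
    chosen. A sequence x chooses the first ball whose bit is set, and the head
    of the cover if there is none, so that every x makes a choice. *)
Definition address (i j k : nat) : nat := npair i (npair j k).

Definition choice_index (i j : nat) (x : nat -> nat) (n : nat) : nat :=
  find (fun k => x (address i j k) != 0) (iota 0 n).

Definition choice (i j : nat) (x : nat -> nat) (l : seq (nat * nat)) :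
    nat * nat :=
  nth (head (0, 0) l) l (choice_index i j x (size l)).

(** Undefined as long as the cover is unknown or sigma lacks a bit that the
    choice might depend on. *)
Definition center (i : nat) (sigma : seq nat) (j : nat) : option nat :=
  if fine_cover i (size sigma) j is Some l then
    if all (fun k => address i j k < size sigma) (iota 0 (size l))
    then Some (choice i j (nth 0 sigma) l).1 else None
  else None.

Definition centers (i : nat) (sigma : seq nat) : seq nat :=
  pmap (center i sigma)
    (iota 0 (find (fun j => ~~ center i sigma j) (iota 0 (size sigma)))).

(** The t-th approximation of a distance is correct up to 2^-t, so this is
    finite evidence for a distance greater than 2^-e. *)
Definition apart (a b e s : nat) : bool :=
  let E := output_prefix eD (flatten (nseq s [:: a; b])) in
  has (fun t => value_gt (nth 0 E t) t e) (iota 0 (size E)).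

Definition interleave (u v : seq nat) : seq nat :=
  flatten [seq [:: nth 0 u k; nth 0 v k]
          | k <- iota 0 (size u - (size u - size v))].

(** Finite evidence that the centres chosen by sigma in the covers of K i do not
    converge fast, or that their limit is outside of the closed set with name
    v; head and tail of v are the code of the program that tests for membership
    in the complement and its parameter. *)
Definition reject (i : nat) (sigma v : seq nat) : bool :=
  has (fun j' => has (fun j =>
      apart (nth 0 (centers i sigma) j) (nth 0 (centers i sigma) j') j.+1
        (size sigma)) (iota 0 j'))
    (iota 0 (size (centers i sigma)))
  || (0 \in output_prefix (head 0 v) (interleave (behead v) (centers i sigma))).

(** Evidence found on a shorter prefix is kept, so that the sequences that are
    not rejected form a tree. *)
Definition rejected (i : nat) (sigma v : seq nat) : bool :=
  has (fun s => reject i (take s sigma) (take s v)) (iota 0 (size sigma).+1).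

Definition bitseqs (s : nat) : seq (seq nat) :=
  iter s (fun L => map (cons 0) L ++ map (cons 1) L) [:: [::]].

Definition all_rejected (i s : nat) (v : seq nat) : bool :=
  all (fun sigma => rejected i sigma v) (bitseqs s).

(** Entries a, a + d, a + 2 d, ... of a list; this undoes the pairings. *)
Definition every (a d s : nat) (u : seq nat) : seq nat :=
  [seq nth 0 u (a + d * k) | k <- iota 0 s].

(** On an input <p, r> with i = r 0, the output has a 0 if all the sequences of
    some length are rejected for i. *)
Definition index_test (n : nat) (u : seq nat) : option nat :=
  if n.*2.+1 < size u then
    Some (if all_rejected (nth 0 u 1) n (every 0 2 n u) then 0 else 1)
  else None.

(** Output n = <i, s> is 0 if the first s bits of the point are rejected for i
    while some other s bits are not. *)
Definition point_test (n : nat) (u : seq nat) : option nat :=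
  if n.*2 <= size u then
    let i := pi1 n in let s := pi2 n in let v := every 0 2 s u in
    Some (if rejected i (every 1 2 s u) v && ~~ all_rejected i s v then 0 else 1)
  else None.

(** Bit k of the point is entry 3 + 4 k of an input <p, <q, x>>, where q names
    the index i; the factor 4 is the reason for the two halvings. *)
Definition output_center (n : nat) (u : seq nat) : option nat :=
  center (nth 0 u 1) (every 3 4 (size u)./2./2 u) n.

(** The n-th entry of <a p, b p>, where a and b are prefixed to p. *)
Definition make_instance (a b n : nat) (u : seq nat) : option nat :=
  if n./2 == 0 then Some (if odd n then b else a) else
  if (n./2).-1 < size u then Some (nth 0 u (n./2).-1) else None.

End Effective.

Section PrimrecEffective.
Context {T : Type} `{encoding T}.
Implicit Types (m n i j : T -> nat) (u : T -> seq nat).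

Lemma primrec_pi1 n : primrec n -> primrec (fun x => pi1 (n x)).
Proof. by move=> pn; rewrite /pi1; primrec_tac. Qed.

Lemma primrec_pi2 n : primrec n -> primrec (fun x => pi2 (n x)).
Proof. by move=> pn; rewrite /pi2; primrec_tac. Qed.

Lemma primrec_odd n : primrec n -> primrec (fun x => odd (n x)).
Proof.
move=> pn; have h : primrec (fun x => iter (n x) negb false) by primrec_tac.
by apply: (primrec_eq h) => x; elim: (n x) => //= k ->.
Qed.

Lemma primrec_half n : primrec n -> primrec (fun x => (n x)./2).
Proof.
move=> pn; have h : primrec (fun x => (iter (n x) (fun st : bool * nat =>
   (~~ st.1, if st.1 then st.2.+1 else st.2)) (false, 0)).2) by primrec_tac.
apply: (primrec_eq h) => x; move: (n x) => k.
suff -> : iter k (fun st : bool * nat =>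
   (~~ st.1, if st.1 then st.2.+1 else st.2)) (false, 0) = (odd k, k./2) by [].
elim: k => // k IHk; rewrite iterS IHk /= uphalf_half.
by case: (odd k).
Qed.

Lemma primrec_double n : primrec n -> primrec (fun x => (n x).*2).
Proof.
move=> pn; have h : primrec (fun x => n x + n x) by primrec_tac.
by apply: (primrec_eq h) => x; rewrite addnn.
Qed.

End PrimrecEffective.

Ltac primrec_user ::= first
  [ simple apply primrec_pi1 | simple apply primrec_pi2
  | simple apply primrec_odd | simple apply primrec_half
  | simple apply primrec_double
  | simple apply primrec_seq_decode | simple apply primrec_output_prefix ].

Section PrimrecCenter.
Context {T : Type} `{encoding T}.
Implicit Types (m n i j : T -> nat) (u : T -> seq nat).

Lemma primrec_center eK i u j :
  primrec i -> primrec u -> primrec j ->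
  primrec (fun x => center eK (i x) (u x) (j x)).
Proof.
move=> pi pu pj.
rewrite /center /fine_cover /fine /decode_cover /radius_le.
rewrite /choice /choice_index /address.
by primrec_tac.
Qed.

End PrimrecCenter.

Ltac primrec_user ::= first
  [ simple apply primrec_pi1 | simple apply primrec_pi2
  | simple apply primrec_odd | simple apply primrec_half
  | simple apply primrec_double
  | simple apply primrec_seq_decode | simple apply primrec_output_prefix
  | simple apply primrec_center ].

Section PrimrecReject.
Context {T : Type} `{encoding T}.
Implicit Types (m n i j a b e s : T -> nat) (u v : T -> seq nat).

Lemma primrec_centers eK i u :
  primrec i -> primrec u -> primrec (fun x => centers eK (i x) (u x)).
Proof. by move=> pi pu; rewrite /centers; primrec_tac. Qed.

Lemma primrec_apart eD a b e s :
  primrec a -> primrec b -> primrec e -> primrec s ->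
  primrec (fun x => apart eD (a x) (b x) (e x) (s x)).
Proof. by move=> pa pb pe ps; rewrite /apart /value_gt; primrec_tac. Qed.

Lemma primrec_interleave u v :
  primrec u -> primrec v -> primrec (fun x => interleave (u x) (v x)).
Proof. by move=> pu pv; rewrite /interleave; primrec_tac. Qed.

Lemma primrec_every a b s u :
  primrec a -> primrec b -> primrec s -> primrec u ->
  primrec (fun x => every (a x) (b x) (s x) (u x)).
Proof. by move=> pa pb ps pu; rewrite /every; primrec_tac. Qed.

Lemma primrec_bitseqs s : primrec s -> primrec (fun x => bitseqs (s x)).
Proof. by move=> ps; rewrite /bitseqs; primrec_tac. Qed.

End PrimrecReject.

Ltac primrec_user ::= first
  [ simple apply primrec_pi1 | simple apply primrec_pi2
  | simple apply primrec_odd | simple apply primrec_half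
  | simple apply primrec_double
  | simple apply primrec_seq_decode | simple apply primrec_output_prefix
  | simple apply primrec_center | simple apply primrec_centers
  | simple apply primrec_apart | simple apply primrec_interleave
  | simple apply primrec_every | simple apply primrec_bitseqs ].

Lemma primrec_reject T `{encoding T} eD eK i u v :
  primrec i -> primrec u -> primrec v ->
  primrec (fun x : T => reject eD eK (i x) (u x) (v x)).
Proof. by move=> pi pu pv; rewrite /reject; primrec_tac. Qed.

Lemma primrec_rejected T `{encoding T} eD eK i u v :
  primrec i -> primrec u -> primrec v ->
  primrec (fun x : T => rejected eD eK (i x) (u x) (v x)).
Proof.
move=> pi pu pv; rewrite /rejected; primrec_tac.
by apply: primrec_reject; primrec_tac.
Qed.

Lemma primrec_all_rejected T `{encoding T} eD eK i s v :
  primrec i -> primrec s -> primrec v ->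
  primrec (fun x : T => all_rejected eD eK (i x) (s x) (v x)).
Proof.
move=> pi ps pv; rewrite /all_rejected; primrec_tac.
by apply: primrec_rejected; primrec_tac.
Qed.

Lemma primrec_index_test eD eK :
  primrec (fun z : nat * seq nat => index_test eD eK z.1 z.2).
Proof.
by rewrite /index_test; primrec_tac; apply: primrec_all_rejected; primrec_tac.
Qed.

Lemma primrec_point_test eD eK :
  primrec (fun z : nat * seq nat => point_test eD eK z.1 z.2).
Proof.
rewrite /point_test; primrec_tac.
  by apply: primrec_rejected; primrec_tac.
by apply: primrec_all_rejected; primrec_tac.
Qed.

Lemma primrec_output_center eK :
  primrec (fun z : nat * seq nat => output_center eK z.1 z.2).
Proof. by rewrite /output_center; primrec_tac. Qed.

Lemma primrec_make_instance a b :
  primrec (fun z : nat * seq nat => make_instance a b z.1 z.2).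
Proof. by rewrite /make_instance; primrec_tac. Qed.

Import Order.TTheory GRing.Theory Num.Theory.
Import numFieldNormedType.Exports.
Local Open Scope classical_set_scope.

(** * Distances and rational approximations *)

Section Rationals.
Variable R : realType.
Local Open Scope ring_scope.

Lemma nuQE n :
  nuQ R n = ((pi1 n)%:R - (pi1 (pi2 n))%:R) / (pi2 (pi2 n)).+1%:R.
Proof.
rewrite /nuQ /pi1 /pi2; case: (Cantor.of_nat n) => i m /=.
by case: (Cantor.of_nat m).
Qed.

Lemma radius_leP r e : radius_le r e = (nuQ R r <= 2 ^- e).
Proof.
rewrite nuQE ler_pdivrMr ?ltr0Sn // mulrC ler_pdivlMr ?exprn_gt0 ?ltr0n //.
rewrite mulrBl lerBlDl /radius_le -natrX -!natrM -natrD ler_nat.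
by [].
Qed.

Lemma value_gtP x t e : value_gt x t e = (2 ^- t + 2 ^- e < nuQ R x).
Proof.
rewrite nuQE ltr_pdivlMr ?ltr0Sn //.
have -> : 2 ^- t + 2 ^- e = (2 ^ t + 2 ^ e)%N%:R / (2 ^ (t + e))%N%:R :> R.
  rewrite natrD !natrX exprD; field.
  by rewrite !expf_neq0 //.
rewrite mulrAC ltr_pdivrMr ?ltr0n ?expn_gt0 // -natrM mulrBl ltrBrDl.
by rewrite -!natrM -natrD ltr_nat [((2 ^ t + 2 ^ e) * _)%N]mulnC.
Qed.

Lemma exp2_gt0 e : 0 < 2 ^- e :> R.
Proof. by rewrite invr_gt0 exprn_gt0. Qed.

Lemma exp2S e : 2 ^- e = 2 ^- e.+1 + 2 ^- e.+1 :> R.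
Proof. by rewrite exprS invfM; field; rewrite expf_neq0. Qed.

Lemma exp2_le e e' : (e <= e')%N -> 2 ^- e' <= 2 ^- e :> R.
Proof. by move=> ee'; rewrite lef_pV2 ?posrE ?exprn_gt0 // ler_weXn2l // ler1n. Qed.

Lemma exp2_small (r : R) : 0 < r -> exists e, 2 ^- e < r.
Proof.
move=> r0; exists (Num.truncn r^-1).+1.
rewrite -[ltRHS]invrK ltf_pV2 ?posrE ?exprn_gt0 ?invr_gt0 //.
apply: lt_trans (truncnS_gt _) _.
by rewrite -natrX ltr_nat ltn_expl.
Qed.

Lemma Real_name_approx q (d : R) t :
  @names (Real_space R) q d -> `|nuQ R (q t) - d| <= 2 ^- t.
Proof.
move=> [cauchy lim]; apply/ler_addgt0Pr => e e0.
have /cvgrPdist_lt /(_ e e0) [N _ hN] := lim.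
pose n := maxn N t.+1.
have h1 : `|d - nuQ R (q n)| < e by apply: hN; rewrite /= leq_maxl.
have h2 : `|nuQ R (q t) - nuQ R (q n)| < 2 ^- t.
  by apply: (cauchy n t); rewrite leq_maxr.
have -> : nuQ R (q t) - d = (nuQ R (q t) - nuQ R (q n)) - (d - nuQ R (q n)) by ring.
by apply: le_trans (ler_normB _ _) _; rewrite lerD // ltW.
Qed.

End Rationals.

Section Distance.
Variables (R : realType) (X : metricType R) (alpha : nat -> X).
Local Open Scope ring_scope.

(** The program is only run on the pairs of constant sequences, which name pairs
    of numbers. *)
Definition distance_program (eD : nat) : Prop := forall a b, exists2 q : baire,
  Phi eD (bpair (fun _ => a) (fun _ => b)) q &
  @names (Real_space R) q (mdist (alpha a) (alpha b)).

Lemma exists_distance_program :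
  computable_metric alpha -> exists eD, distance_program eD.
Proof.
move=> [_ [F [eD FE] Fr]]; exists eD => a b.
pose p := bpair (fun _ => a) (fun _ => b).
have [||q [y [Fpq qy <-]]] := Fr p (a, b).
- by exists (fun _ => a), (fun _ => b).
- by eexists.
by exists q => //; apply/FE.
Qed.

Lemma flatten_pairs (a b s : nat) :
  flatten (nseq s [:: a; b]) =
  mkseq (bpair (fun _ => a) (fun _ => b)) s.*2.
Proof.
elim: s => // s IHs.
have -> : nseq s.+1 [:: a; b] = nseq s [:: a; b] ++ [:: [:: a; b]].
  by rewrite -addn1 nseqD.
by rewrite flatten_cat doubleS !mkseqS -IHs /bpair /= !odd_double -!cats1 -catA.
Qed.

Variable eD : nat.
Hypothesis eDP : distance_program eD.

Lemma apart_sound a b e s :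
  apart eD a b e s -> 2 ^- e < mdist (alpha a) (alpha b).
Proof.
have [q Dq dq] := eDP a b.
move/hasP => [t]; rewrite flatten_pairs mem_iota /= => ts.
rewrite (output_prefix_sound _ Dq) nth_mkseq // (value_gtP R) => gt.
have := Real_name_approx t dq; rewrite ler_distl => /andP[_ le].
by rewrite -(ltrD2l (2 ^- t)) addrC [ltRHS]addrC; lra.
Qed.

Lemma apart_complete a b e : 2 ^- e < mdist (alpha a) (alpha b) ->
  exists s0, forall s, (s0 <= s)%N -> apart eD a b e s.
Proof.
have [q Dq dq] := eDP a b => lt.
have [t ht] : exists t, 2 ^- t < (mdist (alpha a) (alpha b) - 2 ^- e) / 2 :> R.
  by apply: exp2_small; rewrite divr_gt0 // subr_gt0.
have [w0 hw0] := output_prefix_complete t Dq; exists w0 => s ws.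
have ts : (t < size (output_prefix eD (flatten (nseq s [:: a; b]))))%N.
  by rewrite flatten_pairs hw0 //; lia.
apply/hasP; exists t; first by rewrite mem_iota.
rewrite flatten_pairs (output_prefix_sound _ Dq) nth_mkseq; last first.
  by rewrite -flatten_pairs.
rewrite (value_gtP R).
have := Real_name_approx t dq; rewrite ler_distl => /andP[le _].
lra.
Qed.

End Distance.

(** * Fine covers *)

Lemma ohead_filter_mkseq (T : Type) (a : pred T) (f : nat -> T) n m :
  a (f n) -> (forall k, k < n -> ~~ a (f k)) ->
  ohead [seq x <- mkseq f m | a x] = if n < m then Some (f n) else None.
Proof.
move=> an min.
have none k : k <= n -> [seq x <- mkseq f k | a x] = [::].
  elim: k => // k IHk kn; rewrite mkseqS -cats1 filter_cat IHk ?(ltnW kn) //=.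
  by rewrite (negbTE (min _ kn)).
case: ltnP => [nm|mn]; last by rewrite none.
rewrite -(subnKC nm) /mkseq iotaD map_cat filter_cat -/(mkseq f n.+1) mkseqS.
by rewrite -cats1 filter_cat none //= an.
Qed.

Section Covers.
Variables (R : realType) (X : metricType R) (alpha : nat -> X).
Local Open Scope ring_scope.

Lemma ball_mdist (x y : X) e : ball x e y = (mdist x y < e).
Proof. by rewrite ballEmdist. Qed.

Lemma fine_radius j l b : fine j l -> b \in l -> nuQ R b.2 <= 2 ^- j.+2.
Proof. by move=> /allP fl /fl; rewrite (radius_leP R). Qed.

(** A cluster point of the filter generated by the tails of y is recurrent. *)
Lemma compact_recurrent (A : set X) (y : nat -> X) :
  compact A -> (forall n, A (y n)) ->
  exists2 x, A x & forall U N, nbhs x U -> exists2 n, (N <= n)%N & U (y n).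
Proof.
move=> cA Ay; have [|x [Ax clx]] := cA (y @ \oo) _.
  by exists 0%N => // n _; exact: Ay.
exists x => // U N Ux.
have [|z [[n Nn <-] Uy]] := clx [set y n | n in [set n | (N <= n)%N]] U _ Ux.
  by exists N => // n /= Nn; exists n.
by exists n.
Qed.

(** The balls of radius 2^-(j+2) around the points of the dense sequence cover
    A. If no finite number of them did, a sequence of points outside of more and
    more of them would have a recurrent point, which lies in one of the balls
    that the sequence avoids in the end. Balls that miss A are dropped. *)
Lemma exists_fine_cover (A : set X) j : dense (range alpha) -> compact A ->
  exists2 l, meeting_cover alpha A l & fine j l.
Proof.
move=> da cA.
pose r := npair 1 (npair 0 (2 ^ j.+2).-1).
have rE : nuQ R r = 2 ^- j.+2.
  by rewrite nuQE !(pi1K, pi2K) subr0 prednK ?expn_gt0 // natrX mul1r.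
pose B a := ball (alpha a) (nuQ R r).
have r0 : 0 < nuQ R r by rewrite rE exp2_gt0.
have [N AN] : exists N, A `<=` \bigcup_(a in [set a | (a < N)%N]) B a.
  apply: contrapT => /forallNP nocover.
  have /boolp.choice [y hy] N : exists y, A y /\ forall a, (a < N)%N -> ~ B a y.
    have /existsNP [y /not_implyP [Ay nBy]] := nocover N.
    by exists y; split=> // a aN Bay; apply: nBy; exists a.
  have [x Ax clx] := compact_recurrent cA (fun n => (hy n).1).
  have [||z [xa [a _ az]]] := da (ball x (nuQ R r / 2))^°.
  - by exists x; apply: nbhsx_ballx; rewrite divr_gt0.
  - exact: open_interior.
  have {}xa : mdist x (alpha a) < nuQ R r / 2.
    by move/interior_subset: xa; rewrite -az ball_mdist.
  have [n an xn] :=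
    clx _ a.+1 (nbhsx_ballx x (nuQ R r / 2) (divr_gt0 r0 (ltr0Sn R 1))).
  apply: ((hy n).2 a an); rewrite /B ball_mdist.
  rewrite ball_mdist in xn.
  apply: le_lt_trans (metric_triangle _ x _) _.
  by rewrite [nuQ R r]splitr [mdist (alpha a) x]metric_sym ltrD.
exists [seq (a, r) | a <- [seq a <- iota 0 N | `[< A `&` B a !=set0 >]]].
  split=> [x Ax|b /mapP [a]].
    have [a aN Bx] := AN _ Ax; exists (a, r) => //=; apply: map_f.
    rewrite mem_filter mem_iota aN /= andbT.
    by apply/asboolP; exists x.
  by rewrite mem_filter => /andP[/asboolP h _] ->.
apply/allP => b /mapP [a _ ->] /=; rewrite (radius_leP R) rE.
exact: lexx.
Qed.

Variable K : nat -> set X.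

Definition kappa_program (eK : nat) : Prop := forall i, exists2 q : baire,
  Phi eK (fun _ => i) q & kappa_name alpha q (K i).

Lemma exists_kappa_program :
  computable_compact_seq alpha K -> exists eK, kappa_program eK.
Proof.
move=> [F [eK FE] FK]; exists eK => i.
have [q Fq kq] := FK (fun _ => i) i erefl.
by exists q => //; apply/FE.
Qed.

(** L i j is the fine cover of K i that is eventually found. *)
Definition cover_limit (eK : nat) (L : nat -> nat -> seq (nat * nat)) : Prop :=
  forall i j,
  [/\ meeting_cover alpha (K i) (L i j), fine j (L i j),
      forall s l, fine_cover eK i s j = Some l -> l = L i j &
      exists s0, forall s, (s0 <= s)%N -> fine_cover eK i s j = Some (L i j)].

(** The kappa-name lists all covers by balls that meet K i, hence a fine one; the
    one listed first is the limit. *)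
Lemma exists_cover_limit eK : kappa_program eK -> dense (range alpha) ->
  (forall i, compact (K i)) -> exists L, cover_limit eK L.
Proof.
move=> kK da cK.
suff h ij : exists l, [/\ meeting_cover alpha (K ij.1) l, fine ij.2 l,
    forall s l', fine_cover eK ij.1 s ij.2 = Some l' -> l' = l &
    exists s0, forall s, (s0 <= s)%N -> fine_cover eK ij.1 s ij.2 = Some l].
  have [L hL] := boolp.choice h.
  by exists (fun i j => L (i, j)) => i j; exact: (hL (i, j)).
case: ij => i j /=; have [q Pq kq] := kK i.
have [l ml fl] := exists_fine_cover j da (cK i).
have ex : exists n, fine j (decode_cover (q n)).
  have : [set cover_code l | l in meeting_cover alpha (K i)] (cover_code l).
    by exists l.
  by rewrite -kq => -[n _ qn]; exists n; rewrite qn cover_codeK.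
case: (ex_minnP ex) => n fn min.
have E s : fine_cover eK i s j =
    if (n < size (output_prefix eK (nseq s i)))%N
    then Some (decode_cover (q n)) else None.
  rewrite /fine_cover -[nseq s i]mkseq_const {1}(output_prefix_sound _ Pq).
  rewrite /mkseq -map_comp -/(mkseq (decode_cover \o q) _).
  rewrite (ohead_filter_mkseq _ (n := n)) // => k kn.
  by apply/negP => /min; rewrite leqNgt kn.
exists (decode_cover (q n)); split=> //.
- have : range q (q n) by exists n.
  by rewrite kq => -[l' ml' <-]; rewrite cover_codeK.
- by move=> s l'; rewrite E; case: ifP => // _ [].
- have [s0 h] := output_prefix_complete n Pq; exists s0 => s /h.
  by rewrite E mkseq_const => ->.
Qed.

(** The centres form a Cauchy sequence, and they converge because the points of
    A close to them have a cluster point in A. *)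
Lemma compact_limit (A : set X) (c : nat -> X) : compact A ->
  (forall j j', (j < j')%N -> mdist (c j) (c j') <= 2 ^- j.+1) ->
  (forall j, exists2 y, A y & mdist (c j) y < 2 ^- j.+2) ->
  exists x : X, c @ \oo --> x.
Proof.
move=> cA cc cy.
have [y hy] := boolp.choice (fun j => let: ex_intro2 y Ay dy := cy j in
  ex_intro (fun y => A y /\ mdist (c j) y < 2 ^- j.+2) y (conj Ay dy)).
have [x _ clx] := compact_recurrent cA (fun n => (hy n).1).
exists x; apply/metricType_numDomainType.cvgrPdist_lt => e e0.
have [m hm] : exists m, 2 ^- m < e / 2 :> R by apply: exp2_small; rewrite divr_gt0.
have [n mn yx] := clx _ m.+1 (nbhsx_ballx x (e / 4) (divr_gt0 e0 (ltr0Sn R 3))).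
have d1 : mdist x (c n) < e / 2.
  apply: le_lt_trans (metric_triangle _ (y n) _) _.
  rewrite ball_mdist in yx.
  have h : mdist (y n) (c n) < 2 ^- n.+2 by rewrite metric_sym; exact: (hy n).2.
  have h' : 2 ^- n.+2 <= 2 ^- m.+1 :> R by apply: exp2_le; lia.
  by have h2 := exp2S R m; lra.
exists n => // k /= nk.
apply: le_lt_trans (metric_triangle _ (c n) _) _.
move: nk; rewrite leq_eqVlt => /orP[/eqP <- | nk].
  by rewrite mdistxx addr0; lra.
have h' : 2 ^- n.+1 <= 2 ^- m :> R by apply: exp2_le; lia.
by have h2 := cc _ _ nk; lra.
Qed.

End Covers.

(** * Rejection of sequences of choices *)

Lemma take_mkseq (x : nat -> nat) k s :
  k <= s -> take k (mkseq x s) = mkseq x k.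
Proof.
by move=> ks; have := mkseq_prefix x ks; rewrite prefixE size_mkseq => /eqP.
Qed.

Lemma eventually_ltn (P : nat -> nat -> Prop) n :
  (forall j, j < n -> exists s0, forall s, s0 <= s -> P j s) ->
  exists s0, forall s, s0 <= s -> forall j, j < n -> P j s.
Proof.
elim: n => [|n IHn] h; first by exists 0.
have [s0 h0] := IHn (fun j jn => h j (ltnW jn)).
have [s1 h1] := h n (ltnSn n); exists (maxn s0 s1) => s.
rewrite geq_max => /andP[ss0 ss1] j; rewrite ltnS leq_eqVlt => /orP[/eqP ->|].
  exact: h1.
exact: h0.
Qed.

Lemma choice_eq i j x y l :
  (forall k, k < size l -> x (address i j k) = y (address i j k)) ->
  choice i j x l = choice i j y l.
Proof.
move=> xy; rewrite /choice /choice_index; congr nth.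
by apply: eq_in_find => k; rewrite mem_iota => /xy ->.
Qed.

Lemma choice_mem i j x l : 0 < size l -> choice i j x l \in l.
Proof.
rewrite /choice; case: l => // b l _.
case: (ltnP (choice_index i j x (size (b :: l))) (size (b :: l))) => h.
  exact: mem_nth.
by rewrite nth_default // mem_head.
Qed.

Lemma interleave_mkseq (a b : nat -> nat) m n :
  interleave (mkseq a m) (mkseq b n) = mkseq (bpair a b) (minn m n).*2.
Proof.
rewrite /interleave !size_mkseq.
have -> : m - (m - n) = minn m n by rewrite minnE.
have : minn m n <= m /\ minn m n <= n by lia.
elim: (minn m n) => // k IHk [km kn].
rewrite -addn1 iotaD map_cat flatten_cat IHk; last by split; exact: ltnW.
rewrite addn1 doubleS !mkseqS -!cats1 -catA /= add0n !nth_mkseq //.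
by rewrite /bpair /= odd_double /= uphalf_double doubleK.
Qed.

Lemma output_prefix_nil n : output_prefix n [::] = [::].
Proof. by []. Qed.

Section Reject.
Variables (R : realType) (X : metricType R) (alpha : nat -> X).
Variables (eD eK : nat) (K : nat -> set X) (L : nat -> nat -> seq (nat * nat)).
Hypothesis eDP : distance_program alpha eD.
Hypothesis LP : cover_limit alpha K eK L.
Hypothesis Kc : forall i, compact (K i).
Hypothesis K0 : forall i, K i !=set0.

Definition chosen (i : nat) (x : nat -> nat) (j : nat) : nat :=
  (choice i j x (L i j)).1.

Lemma L_choice_mem i j x : choice i j x (L i j) \in L i j.
Proof.
have [[cov _] _ _ _] := LP i j; apply: choice_mem.
by have [y /cov [b bL _]] := K0 i; case: (L i j) bL.
Qed.

Lemma center_sound i x s j c :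
  center eK i (mkseq x s) j = Some c -> c = chosen i x j.
Proof.
rewrite /center size_mkseq; case E: fine_cover => [l|] //.
have [_ _ /(_ _ _ E) -> _] := LP i j.
case: allP => // h [<-]; congr fst; apply: choice_eq => k kl.
by rewrite nth_mkseq // h // mem_iota.
Qed.

Lemma center_complete i x j : exists s0, forall s, s0 <= s ->
  center eK i (mkseq x s) j = Some (chosen i x j).
Proof.
have [_ _ _ [s0 h0]] := LP i j.
pose M := \max_(k < size (L i j)) address i j k.
exists (maxn s0 M.+1) => s; rewrite geq_max => /andP[ss0 sM].
have h : center eK i (mkseq x s) j.
  rewrite /center size_mkseq h0 //; case: allP => // -[] k.
  rewrite mem_iota => kl; apply: leq_trans sM.
  rewrite ltnS.
  exact: (@leq_bigmax _ (fun k : 'I_(size (L i j)) => address i j k)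
    (Ordinal kl)).
by case e: center h => [c|] // _; rewrite (center_sound e).
Qed.

Lemma centers_sound i x s : centers eK i (mkseq x s) =
  mkseq (chosen i x) (find (fun j => ~~ center eK i (mkseq x s) j) (iota 0 s)).
Proof.
rewrite /centers size_mkseq; set m := find _ _.
have ms : m <= s by rewrite -[leqRHS](size_iota 0) find_size.
have h j : j < m -> center eK i (mkseq x s) j = Some (chosen i x j).
  move=> jm; have := before_find 0 jm; rewrite nth_iota ?(leq_trans jm) // add0n.
  by case e: center => [c|] // _; rewrite (center_sound e).
elim: m {ms} h => // m IHm h; rewrite mkseqS -cats1 -IHm; last first.
  by move=> j jm; apply: h; exact: ltnW.
by rewrite -addn1 iotaD pmap_cat /= add0n h.
Qed.

Lemma centers_complete i x n : exists s0, forall s, s0 <= s ->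
  n <= size (centers eK i (mkseq x s)).
Proof.
have [s0 h0] := eventually_ltn (n := n) (fun j _ => center_complete i x j).
exists (maxn s0 n) => s; rewrite geq_max => /andP[ss0 sn].
rewrite centers_sound size_mkseq leqNgt; apply/negP => mn.
set m := find _ _ in mn.
have ms : m < size (iota 0 s) by rewrite size_iota (leq_trans mn).
have hs : has (fun j => ~~ center eK i (mkseq x s) j) (iota 0 s).
  by rewrite has_find.
have := nth_find 0 hs.
rewrite -/m nth_iota ?add0n; last by rewrite -[ltnRHS](size_iota 0).
by rewrite (h0 _ ss0).
Qed.

Lemma nth_centers i x s j : j < size (centers eK i (mkseq x s)) ->
  nth 0 (centers eK i (mkseq x s)) j = chosen i x j.
Proof. by rewrite centers_sound size_mkseq => jm; rewrite nth_mkseq. Qed.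

Section ClosedSet.
Variables (A : set X) (p : baire).
Hypothesis pA : @function_name (Cauchy_space alpha) Sierpinski p
  (@char_fun (Cauchy_space alpha) (~` A)).

(** A name of A acts on the Cauchy names of points as a test for the complement
    of A. *)
Lemma run_test r (a : X) : @names (Cauchy_space alpha) r a ->
  exists2 q, Phi (p 0) (bpair (btail p) r) q & (exists n, q n = 0) <-> ~ A a.
Proof.
move=> ra; have [|q [y [Pq qy ya]]] := pA ra; first by eexists.
exists q => //; move: qy; rewrite /= ya /char_fun => qy.
by split=> [/qy.2/set_mem|nAa]; last by apply: qy.1; exact: mem_set.
Qed.

(** The node sigma of the i-th tree is cut off on the basis of the entries of the
    name of A with positions below the length of sigma. *)
Definition pruned (i : nat) (sigma : seq nat) : bool :=
  rejected eD eK i sigma (mkseq p (size sigma)).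

Lemma prunedP i x s : pruned i (mkseq x s) <->
  exists2 k, k <= s & reject eD eK i (mkseq x k) (mkseq p k).
Proof.
rewrite /pruned /rejected size_mkseq; split.
  case/hasP => k; rewrite mem_iota /= ltnS => ks.
  by rewrite !take_mkseq //; exists k.
move=> [k ks h]; apply/hasP; exists k; first by rewrite mem_iota ltnS.
by rewrite !take_mkseq.
Qed.

Local Open Scope ring_scope.

(** All the evidence that [reject] accepts is conclusive, as finite outputs are
    parts of the true ones. *)
Lemma pruned_sound i x (a : X) :
  (forall j j', (j < j')%N ->
    mdist (alpha (chosen i x j)) (alpha (chosen i x j')) <= 2 ^- j.+1) ->
  @names (Cauchy_space alpha) (chosen i x) a -> A a ->
  forall s, ~~ pruned i (mkseq x s).
Proof.
move=> dx xa Aa s; apply/negP => /prunedP [k _] /orP[|].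
  case/hasP => j'; rewrite mem_iota /= => j's /hasP [j].
  rewrite mem_iota /= add0n => jj'; rewrite !nth_centers ?(ltn_trans jj') //.
  by move/(apart_sound eDP); rewrite ltNge dx.
case: k => [|k]; first by rewrite output_prefix_nil.
have [q Pq qA] := run_test xa.
have -> : mkseq p k.+1 = p 0 :: mkseq (btail p) k.
  by rewrite /mkseq /= (iotaDl 1 0) -map_comp.
rewrite centers_sound interleave_mkseq /= (output_prefix_sound _ Pq).
by move=> /mapP [n _ /esym qn]; apply/qA: Aa; exists n.
Qed.

(** Centres that are too far apart, or a limit outside of A, would eventually be
    noticed. So the centres are a Cauchy name, which has a limit because they
    are close to points of the compact set K i. *)
Lemma pruned_complete i x : (forall s, ~~ pruned i (mkseq x s)) ->
  exists2 a : X, @names (Cauchy_space alpha) (chosen i x) a & A a.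
Proof.
move=> nrej.
have nreject s : ~~ reject eD eK i (mkseq x s) (mkseq p s).
  by apply: contra (nrej s) => h; apply/prunedP; exists s.
have dx j j' : (j < j')%N ->
    mdist (alpha (chosen i x j)) (alpha (chosen i x j')) <= 2 ^- j.+1.
  move=> jj'; rewrite leNgt; apply/negP => /(apart_complete eDP) [s0 h0].
  have [s1 h1] := centers_complete i x j'.+1.
  have := nreject (maxn s0 s1); rewrite /reject negb_or => /andP[/negP + _]; apply.
  have j's := h1 _ (leq_maxr s0 s1).
  apply/hasP; exists j'; first by rewrite mem_iota.
  apply/hasP; exists j; first by rewrite mem_iota.
  rewrite !nth_centers ?(ltn_trans jj') // size_mkseq.
  exact: h0 (leq_maxl _ _).
have dy j : exists2 y, K i y & mdist (alpha (chosen i x j)) y < 2 ^- j.+2.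
  have [[_ meet] fL _ _] := LP i j; have bL := L_choice_mem i j x.
  have [y [Ky By]] := meet _ bL; exists y => //.
  by rewrite /rball ball_mdist in By; apply: lt_le_trans By (fine_radius R fL bL).
have [a xa] := compact_limit (@Kc i) dx dy.
have na : @names (Cauchy_space alpha) (chosen i x) a.
  split=> // m j jm; rewrite metric_sym; apply: le_lt_trans (dx _ _ jm) _.
  by rewrite [ltRHS]exp2S ltrDl exp2_gt0.
exists a => //; apply: contrapT => nAa.
have [q Pq qA] := run_test na; have [n qn] := qA.2 nAa.
have [w0 h0] := output_prefix_complete n Pq.
have [s1 h1] := centers_complete i x w0.
pose s := (maxn w0 s1).
have /negP := nreject s.+1; apply; apply/orP; right.
have -> : mkseq p s.+1 = p 0 :: mkseq (btail p) s.
  by rewrite /mkseq /= (iotaDl 1 0) -map_comp.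
have w0s : (w0 <= size (centers eK i (mkseq x s.+1)))%N.
  by apply: h1; rewrite /s; lia.
rewrite [head _ _]/= [behead _]/= centers_sound interleave_mkseq.
have lt : (n < size (output_prefix (p 0) (mkseq (bpair (btail p) (chosen i x))
    (minn s (find (fun j => ~~ center eK i (mkseq x s.+1) j)
      (iota 0 s.+1))).*2)))%N.
  apply: h0; move: w0s; rewrite centers_sound size_mkseq /s; lia.
rewrite (output_prefix_sound _ Pq); apply/mapP; exists n => //.
by rewrite mem_iota.
Qed.

End ClosedSet.
End Reject.

(** * Branches of binary trees *)

Lemma mem_bitseqs s sigma :
  (sigma \in bitseqs s) = (size sigma == s) && all (fun b => b < 2) sigma.
Proof.
elim: s sigma => [|s IHs] [|b sigma] //.
  rewrite /bitseqs iterS mem_cat; apply/negbTE; rewrite negb_or.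
  by apply/andP; split; apply/negP => /mapP [].
rewrite /bitseqs iterS -/(bitseqs s) mem_cat /= eqSS.
have E c : (b :: sigma \in map (cons c) (bitseqs s)) =
    (b == c) && (sigma \in bitseqs s).
  apply/mapP/andP => [[t ts [-> ->]]|[/eqP -> ts]]; last by exists sigma.
  by rewrite eqxx.
by rewrite !E IHs; case: b {E} => [|[|b]]; rewrite /= ?orbF ?andbF.
Qed.

Lemma mkseq_bitseqs (x : nat -> bool) s :
  mkseq (fun n => x n : nat) s \in bitseqs s.
Proof.
rewrite mem_bitseqs size_mkseq eqxx /=.
by apply/allP => b /mapP [k _ ->]; case: (x k).
Qed.

Section Konig.
Variable cut : pred (seq nat).
Hypothesis cut_cat : forall sigma tau, cut sigma -> cut (sigma ++ tau).

Lemma cut_take k sigma : cut (take k sigma) -> cut sigma.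
Proof. by move=> h; rewrite -(cat_take_drop k sigma); exact: cut_cat. Qed.

(** Koenig's lemma for the tree of the sequences that are not cut: a node above
    which there are nodes of all lengths has a child with the same property,
    since cuts are inherited by extensions. *)
Lemma konig : (forall s, ~~ all cut (bitseqs s)) ->
  exists x : nat -> bool, forall s, ~~ cut (mkseq (fun n => x n : nat) s).
Proof.
move=> open.
pose good sigma := forall n, exists2 tau, tau \in bitseqs n & ~~ cut (sigma ++ tau).
have good0 : good [::] by move=> n; have /allPn := open n.
have goodS sigma : good sigma -> good (rcons sigma 0) \/ good (rcons sigma 1).
  move=> gs; apply: contrapT => /not_orP [/existsNP [n0 h0] /existsNP [n1 h1]].
  have [tau] := gs (maxn n0 n1).+1.
  rewrite mem_bitseqs; case: tau => // b tau.
  move=> /andP[/eqP [stau] /andP[b2 btau]] /negP; apply.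
  have stop n : (forall tau', tau' \in bitseqs n -> cut (rcons sigma b ++ tau')) ->
      n <= size tau -> cut (sigma ++ b :: tau).
    move=> h ntau; rewrite -cat_rcons.
    rewrite -(cat_take_drop n tau) catA; apply/cut_cat/h.
    rewrite mem_bitseqs size_takel // eqxx; apply/allP => c /mem_take.
    exact: (allP btau).
  case: b b2 stop => [|[|]] // _ stop.
    apply: (stop n0); last by rewrite stau leq_maxl.
    by move=> tau' ht; apply: contrapT => /negP ncut; apply: h0; exists tau'.
  apply: (stop n1); last by rewrite stau leq_maxr.
  by move=> tau' ht; apply: contrapT => /negP ncut; apply: h1; exists tau'.
pose bit sigma := ~~ `[< good (rcons sigma 0) >].
pose path := fix path s :=
  if s is s'.+1 then rcons (path s') (bit (path s')) else [::].
have gpath s : good (path s).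
  elim: s => //= s IHs; rewrite /bit; case: asboolP => // ng.
  by case: (goodS _ IHs).
exists (fun s => bit (path s)) => s.
have -> : mkseq (fun n => bit (path n) : nat) s = path s.
  by elim: s => // s IHs; rewrite mkseqS IHs.
have [tau] := gpath s 0; rewrite mem_bitseqs => /andP[/nilP -> _].
by rewrite cats0.
Qed.

(** If the tree is infinite, x is a branch. Otherwise x follows a node on the
    last non-empty level, and where x is cut, everything is. *)
Lemma late_branch : exists x : nat -> bool,
  forall s, cut (mkseq (fun n => x n : nat) s) -> all cut (bitseqs s).
Proof.
have [ex|nex] := pselect (exists s, all cut (bitseqs s)); last first.
  have [|x hx] := konig.
    by move=> s; apply/negP => h; apply: nex; exists s.
  by exists x => s; rewrite (negbTE (hx s)).
case: (ex_minnP ex) => s0 all0 min.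
have late s : s0 <= s -> all cut (bitseqs s).
  move=> ss; apply/allP => sigma; rewrite mem_bitseqs => /andP[/eqP ssig bsig].
  apply: (cut_take (k := s0)); apply: (allP all0).
  rewrite mem_bitseqs size_takel ?ssig // eqxx; apply/allP => c /mem_take.
  exact: (allP bsig).
case: s0 => [|s0] in all0 min late *.
  by exists (fun=> false) => s _; exact: late.
have /allPn [tau] : ~~ all cut (bitseqs s0) by apply/negP => /min; rewrite ltnn.
rewrite mem_bitseqs => /andP[/eqP stau btau] ncut.
exists (fun n => nth 0 tau n != 0) => s.
have [ss0 _|ss0] := ltnP s0 s; first exact: late.
have -> : mkseq (fun n => (nth 0 tau n != 0) : nat) s = take s tau.
  apply: (@eq_from_nth _ 0); first by rewrite size_mkseq size_takel ?stau.
  move=> k; rewrite size_mkseq => ks; rewrite nth_mkseq // nth_take //.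
  have /(allP btau) : nth 0 tau k \in tau by rewrite mem_nth // stau (leq_trans ks).
  by case: (nth 0 tau k) => [|[|]].
by move=> /cut_take; rewrite (negbTE ncut).
Qed.

End Konig.

Section Instance.
Variables (R : realType) (X : metricType R) (alpha : nat -> X).
Variables (eD eK : nat) (K : nat -> set X) (L : nat -> nat -> seq (nat * nat)).
Hypothesis eDP : distance_program alpha eD.
Hypothesis LP : cover_limit alpha K eK L.
Hypothesis Kc : forall i, compact (K i).
Hypothesis K0 : forall i, K i !=set0.

Variables (A : set X) (p : baire).
Hypothesis pA : @function_name (Cauchy_space alpha) Sierpinski p
  (@char_fun (Cauchy_space alpha) (~` A)).

Local Notation cut := (pruned eD eK p).

Lemma pruned_cat i sigma tau : cut i sigma -> cut i (sigma ++ tau).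
Proof.
move=> /hasP [k]; rewrite mem_iota /= ltnS => ks h.
apply/hasP; exists k; first by rewrite mem_iota /= size_cat; lia.
rewrite takel_cat // take_mkseq //; last by rewrite size_cat; lia.
by rewrite take_mkseq in h.
Qed.

(** Choices for i only depend on the bits whose address starts with i. *)
Lemma pruned_local i (x y : nat -> nat) s :
  (forall m, x (npair i m) = y (npair i m)) ->
  cut i (mkseq x s) = cut i (mkseq y s).
Proof.
move=> xy.
have nthE k m : nth 0 (mkseq x k) (npair i m) = nth 0 (mkseq y k) (npair i m).
  have [mk|km] := ltnP (npair i m) k; first by rewrite !nth_mkseq.
  by rewrite !nth_default ?size_mkseq.
have cE k : center eK i (mkseq x k) = center eK i (mkseq y k).
  apply/funext => j; rewrite /center !size_mkseq; case: fine_cover => // l.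
  by congr (if _ then Some _.1 else _); apply: choice_eq => n _; exact: nthE.
have rE k v : reject eD eK i (mkseq x k) v = reject eD eK i (mkseq y k) v.
  by rewrite /reject /centers !size_mkseq cE.
by apply/idP/idP => /prunedP [k ks h]; apply/prunedP; exists k => //;
  rewrite ?rE // -rE.
Qed.

(** The indices i for which the tree of the sequences that are not rejected is
    infinite. *)
Definition index_set : set nat :=
  [set i | forall s, ~~ all_rejected eD eK i s (mkseq p s)].

(** The sequences that are rejected for i only when everything is: this is a
    non-empty closed condition for every i, and it says that x is a branch if
    the tree of i is infinite. *)
Definition point_set : set (nat -> bool) :=
  [set x | forall i s, cut i (mkseq (fun n => x n : nat) s) ->
                       all_rejected eD eK i s (mkseq p s)].

Lemma all_rejectedE i s :
  all_rejected eD eK i s (mkseq p s) = all (cut i) (bitseqs s).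
Proof.
apply: eq_in_all => sigma; rewrite mem_bitseqs => /andP[/eqP sE _].
by rewrite /pruned sE.
Qed.

Local Open Scope ring_scope.

(** The bits of x are set for exactly those balls that contain the point a. The
    chosen centres are then within 2^-(j+2) of a, so that they name a. *)
Lemma exists_unrejected i a : A a -> K i a ->
  exists x : nat -> bool, forall s, ~~ cut i (mkseq (fun n => x n : nat) s).
Proof.
move=> Aa Ka.
pose x n := `[< rball alpha (nth (0, 0)%N (L i (pi1 (pi2 n))) (pi2 (pi2 n))) a >].
pose x' n : nat := x n.
have chosenP j : rball alpha (choice i j x' (L i j)) a.
  have [[cov _] _ _ _] := LP i j; have [b /= bL ba] := cov _ Ka.
  pose t := (fun k => x' (address i j k) != 0%N).
  have xE k : t k = `[< rball alpha (nth (0, 0)%N (L i j) k) a >].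
    by rewrite /t /x' /x /address pi2K pi1K pi2K; case: asbool.
  have ht : has t (iota 0 (size (L i j))).
    apply/hasP; exists (index b (L i j)); first by rewrite mem_iota index_mem.
    by rewrite xE nth_index //; apply/asboolP.
  have lt : (find t (iota 0 (size (L i j))) < size (L i j))%N.
    by rewrite -[ltnRHS](size_iota 0) -has_find.
  have := nth_find 0%N ht; rewrite nth_iota //.
  rewrite xE add0n => /asboolP; rewrite /choice /choice_index -/t.
  by congr (rball _ _ _); exact: set_nth_default.
have da j : mdist (alpha (chosen L i x' j)) a < 2 ^- j.+2.
  have := chosenP j; rewrite /rball ball_mdist => h; apply: lt_le_trans h _.
  have [_ fL _ _] := LP i j.
  exact: fine_radius fL (L_choice_mem LP K0 i j x').
exists x; apply: (pruned_sound eDP LP pA (a := a)) => //.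
  move=> j j' jj'; apply: le_trans (metric_triangle _ a _) _.
  rewrite [mdist a _]metric_sym [leRHS]exp2S; apply: lerD; first exact: ltW.
  by apply: le_trans (ltW (da j')) _; apply: exp2_le; lia.
split.
  move=> m j jm; rewrite metric_sym; apply: le_lt_trans (metric_triangle _ a _) _.
  rewrite [mdist a _]metric_sym [ltRHS]exp2S; apply: ltrD.
    by apply: lt_le_trans (da j) _; apply: exp2_le; lia.
  by apply: lt_le_trans (da m) _; apply: exp2_le; lia.
apply/metricType_numDomainType.cvgrPdist_lt => e e0.
have [m hm] := exp2_small e0.
exists m => // n /= mn; rewrite metric_sym; apply: lt_trans (da n) _.
by apply: le_lt_trans hm; apply: exp2_le; lia.
Qed.

Lemma index_set_nonempty : A !=set0 -> \bigcup_i K i = setT -> index_set !=set0.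
Proof.
move=> [a Aa] KT; have [i _ Kia] : (\bigcup_i K i) a by rewrite KT.
have [x hx] := exists_unrejected Aa Kia; exists i => s.
rewrite all_rejectedE; apply/allPn; exists (mkseq (fun n => x n : nat) s) => //.
exact: mkseq_bitseqs.
Qed.

(** For each i there is a suitable sequence; as the trees for different i depend
    on disjoint sets of bits, these sequences can be merged. *)
Lemma point_set_nonempty : point_set !=set0.
Proof.
have /boolp.choice [x hx] i := late_branch (pruned_cat (i := i)).
exists (fun n => x (pi1 n) n) => i s.
rewrite all_rejectedE (@pruned_local i _ (fun n => x i n : nat)); first exact: hx.
by move=> m; rewrite pi1K.
Qed.

Lemma selected_point i x : index_set i -> point_set x ->
  exists2 a : X,
    @names (Cauchy_space alpha) (chosen L i (fun n => x n : nat)) a & A a.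
Proof.
move=> Bi Dx; apply: (pruned_complete eDP LP Kc K0 pA) => s.
by apply: contra (Bi s); exact: Dx.
Qed.

End Instance.

(** * Names of closed sets *)

(** Continuity with a modulus that is the same for all arguments, which is what
    the tests below have. *)
Definition prefix_determined (f : baire -> baire) : Prop :=
  forall n, exists m, forall r r', mkseq r m = mkseq r' m -> f r n = f r' n.

Lemma nbhs_prefix (r : baire) m :
  nbhs r [set r' : baire | mkseq r' m = mkseq r m].
Proof.
elim: m => [|m IHm]; first exact: filterE.
have near_m : nbhs r [set r' : baire | r' m = r m].
  exact: (@proj_continuous nat (fun _ => nat) m r _ (discrete_set1 (r m))).
apply: filterS2 IHm near_m => r' /= e em.
by rewrite !mkseqS e em.
Qed.

Lemma prefix_determined_continuous f : prefix_determined f -> continuous f.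
Proof.
move=> hf r; apply/(pointwise_cvgP (f r)) => n.
apply/discrete_cvg; have [m hm] := hf n.
apply: filterS (nbhs_prefix r m) => r' /= e.
exact/esym/hm/esym.
Qed.

Definition bcons (n : nat) (p : baire) : baire :=
  fun k => if k is k'.+1 then p k' else n.

Lemma total_pfun_single (f : baire -> baire) p q q' :
  f p = q -> f p = q' -> q = q'.
Proof. by move=> <- <-. Qed.

Definition total_pfun (f : baire -> baire) : pfun :=
  PFun (@total_pfun_single f).

(* A map f whose value at a name of x contains a 0 if and only if x is outside of
   B shows that B is closed; a program that computes f from a parameter p turns p
   into a name of B. *)
Section ClosedNames.
Variables (X : rspace) (B : set X) (f : baire -> baire).
Hypothesis fB : forall r x, names r x -> (exists n, f r n = 0) <-> ~ B x.

Lemma test_realizes r x : names r x ->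
  @names Sierpinski (f r) (@char_fun X (~` B) x).
Proof.
move=> /fB rx; rewrite /= /char_fun.
by split=> [/set_mem /rx|/rx nBx]; last exact: mem_set.
Qed.

Lemma test_closed : prefix_determined f -> rclosed B.
Proof.
move=> hf; exists (total_pfun f).
  exists f; split; first by move=> r q ->.
  exact/continuous_subspaceT/prefix_determined_continuous.
move=> r x rx _; exists (f r), (@char_fun X (~` B) x); split=> //.
exact: test_realizes.
Qed.

Lemma test_name P p : (forall r, computes P (bpair p r) (f r)) ->
  @function_name X Sierpinski (bcons (program_code P) p) (@char_fun X (~` B)).
Proof.
move=> cf r x rx _; exists (f r), (@char_fun X (~` B) x); split=> //.
  by exists P => //; exact: cf.
exact: test_realizes.
Qed.

End ClosedNames.

(** * The reduction *)

Lemma every_mkseq a d s (y : nat -> nat) w :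
  (forall k, k < s -> a + d * k < w) ->
  every a d s (mkseq y w) = mkseq (fun k => y (a + d * k)) s.
Proof.
move=> h; apply/eq_in_map => k; rewrite mem_iota => ks.
by rewrite nth_mkseq // h.
Qed.

Lemma bpair_even p q k : bpair p q (0 + 2 * k) = p k.
Proof. by rewrite add0n mul2n /bpair odd_double doubleK. Qed.

Lemma bpair_odd p q k : bpair p q (1 + 2 * k) = q k.
Proof. by rewrite add1n mul2n /bpair /= odd_double /= uphalf_double. Qed.

Section Tests.
Variables (eD eK : nat).

Definition index_output (p r : baire) : baire :=
  fun n => if all_rejected eD eK (r 0) n (mkseq p n) then 0 else 1.

Definition point_output (p r : baire) : baire := fun n =>
  if rejected eD eK (pi1 n) (mkseq r (pi2 n)) (mkseq p (pi2 n)) &&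
     ~~ all_rejected eD eK (pi1 n) (pi2 n) (mkseq p (pi2 n)) then 0 else 1.

Lemma index_machine :
  exists P, forall p r, computes P (bpair p r) (index_output p r).
Proof.
have [P hP] := primrec_machine (primrec_index_test eD eK).
exists P => p r; apply: hP => [n w v|n].
  rewrite /index_test size_mkseq; case: ltnP => // nw [<-].
  rewrite nth_mkseq; last by apply: leq_trans nw.
  rewrite every_mkseq; last by move=> k kn; lia.
  by under eq_mkseq do rewrite bpair_even.
by exists n.*2.+2 => w nw; rewrite /index_test size_mkseq nw.
Qed.

Lemma pi2_leq n : pi2 n <= n.
Proof.
have := Cantor.cancel_to_of n; rewrite /pi2; case: (Cantor.of_nat n) => a b /= nE.
have : n = b + tri (b + a) by rewrite -nE.
by lia.
Qed.

Lemma point_machine :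
  exists P, forall p r, computes P (bpair p r) (point_output p r).
Proof.
have [P hP] := primrec_machine (primrec_point_test eD eK).
exists P => p r; apply: hP => [n w v|n].
  rewrite /point_test size_mkseq; case: leqP => // nw [<-].
  have n2 := pi2_leq n.
  rewrite !every_mkseq; try by move=> k kn; lia.
  under eq_mkseq do rewrite bpair_odd.
  by under [mkseq (fun k => bpair p r (0 + _)) _]eq_mkseq do rewrite bpair_even.
by exists n.*2 => w nw; rewrite /point_test size_mkseq nw.
Qed.

End Tests.

Lemma output_machine (R : realType) (X : metricType R) (alpha : nat -> X)
    eK K L :
  cover_limit alpha K eK L ->
  exists P, forall p g1 g2, computes P (bpair p (bpair g1 g2)) (chosen L (g1 0) g2).
Proof.
move=> LP; have [P hP] := primrec_machine (primrec_output_center eK).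
exists P => p g1 g2.
have uE w : output_center eK ^~ (mkseq (bpair p (bpair g1 g2)) w) =1
    center eK (nth 0 (mkseq (bpair p (bpair g1 g2)) w) 1) (mkseq g2 w./2./2).
  move=> n; rewrite /output_center size_mkseq every_mkseq; last by move=> k; lia.
  congr center; apply: eq_mkseq => k.
  have -> : 3 + 4 * k = 1 + 2 * (1 + 2 * k) by lia.
  by rewrite !bpair_odd.
apply: hP => [n w v|n].
  rewrite uE; case: (ltnP w 4) => [w4|w4]; last first.
    rewrite nth_mkseq; last by lia.
    by move/(center_sound LP).
  (* Fewer than four entries contain no bit, and covers are then searched for in
     0 steps. *)
  have -> : w./2./2 = 0 by lia.
  by rewrite /center /fine_cover output_prefix_nil.
have [s0 h0] := center_complete LP (g1 0) g2 n.
exists (4 * s0).+2 => w ws; rewrite uE nth_mkseq; last by lia.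
rewrite h0 //; lia.
Qed.

Lemma instance_machine a b : exists P, forall p,
  computes P p (bpair (bcons a p) (bcons b p)).
Proof.
have [P hP] := primrec_machine (primrec_make_instance a b).
exists P => p; apply: hP => [n w v|n].
  rewrite /make_instance size_mkseq /bpair /bcons.
  case: (n./2) => [|k] /=; first by case: (odd n) => -[].
  by case: ltnP => // kw [<-]; rewrite nth_mkseq // if_same.
exists n => w nw; rewrite /make_instance size_mkseq; case: eqP => // n2.
have -> // : (n./2).-1 < w by lia.
Qed.

Theorem proposition4p8 (R : realType) (X : metricType R) (alpha : nat -> X)
    (hX : computable_Ksigma alpha) :
  weihrauch_le (closed_choice (X := Cauchy_space alpha))
    (mprod (closed_choice (X := Nat_space)) (closed_choice (X := Cantor_space))).
Proof.
have [mX [K [K_ Kseq KT]]] := hX.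
have K0 i : K i !=set0 by have [] := K_ i.
have Kc i : compact (K i) by have [_ []] := K_ i.
have [eD eDP] := exists_distance_program mX.
have [eK eKP] := exists_kappa_program Kseq.
have [L LP] := exists_cover_limit eKP mX.1 Kc.
have [PB cB] := index_machine eD eK.
have [PD cD] := point_machine eD eK.
have [PK cK] := output_machine LP.
have [PH cH] := instance_machine (program_code PB) (program_code PD).
exists (Phi (program_code PK)), (Phi (program_code PH)); split.
- by exists (program_code PK).
- by exists (program_code PH).
move=> G Gr p A pA [a Aa].
pose B := index_set eD eK p; pose D := point_set eD eK p.
have fB r i : @names Nat_space r i ->
    (exists n, index_output eD eK p r n = 0) <-> ~ B i.
  rewrite /= => ri; rewrite /index_output ri; split.
    by move=> [n]; case: ifP => // h _ /(_ n); rewrite h.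
  by move=> /existsNP [n /negP /negPn h]; exists n; rewrite h.
have fD r x : @names Cantor_space r x ->
    (exists n, point_output eD eK p r n = 0) <-> ~ D x.
  rewrite /= => rx; have -> : r = (fun n => x n : nat) by apply/funext.
  rewrite /point_output; split.
    move=> [n]; case: ifP => // /andP[h1 h2] _ /(_ (pi1 n) (pi2 n)).
    by rewrite /pruned size_mkseq => /(_ h1); exact/negP.
  move=> /existsNP [i /existsNP [s /not_implyP [h1 /negP h2]]].
  exists (npair i s); rewrite pi1K pi2K; move: h1; rewrite /pruned size_mkseq => ->.
  by rewrite h2.
have Bclosed : @rclosed Nat_space B.
  apply: (test_closed fB) => n; exists 1 => r r' [r0].
  by rewrite /index_output r0.
have Dclosed : @rclosed Cantor_space D.
  apply: (test_closed fD) => n; exists (pi2 n) => r r' e.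
  by rewrite /point_output e.
have Bname := test_name fB (cB p).
have Dname := test_name fD (cD p).
have pA' := pA : @function_name (Cauchy_space alpha) Sierpinski p
  (@char_fun (Cauchy_space alpha) (~` sval A)).
have [i Bi] : B !=set0.
  by apply: (index_set_nonempty eDP LP K0 pA') => //; exists a.
have [x Dx] := point_set_nonempty eD eK p : D !=set0.
pose h := bpair (bcons (program_code PB) p) (bcons (program_code PD) p).
pose z : prod_space (Aminus Nat_space) (Aminus Cantor_space) :=
  (exist _ B Bclosed, exist _ D Dclosed).
have hz : names h z.
  by exists (bcons (program_code PB) p), (bcons (program_code PD) p).
have [|g [[i' x'] [Gg [g1 [g2 [gE /= g1i g2x]]] [/= Bi' Dx']]]] := Gr h z hz.
  by exists (i, x).
have [b bn Ab] := selected_point eDP LP Kc K0 pA' Bi' Dx'.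
exists (chosen L i' (fun n => x' n : nat)), b; split=> //.
exists h, g; split=> //; first by exists PH.
exists PK => //; have := cK p g1 g2.
by rewrite gE g1i; have -> : g2 = (fun n => x' n : nat) by apply/funext.
Qed.
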